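(* Let $\beta>0$. For each $n\ge 1$ let $(Z^{(n)}_k)_{1\le k\le n}$ be a random family of points in $\mathbb{C}$, with empirical measure $\mu_n=\frac1n\sum_{k=1}^n\delta_{Z^{(n)}_k}$, and let $(\gamma^{(n)}_k)_{1\le k\le n}$ be i.i.d. Gamma random variables of parameter $\beta/2$, independent of $(Z^{(n)}_k)_{1\le k\le n}$. For $n\ge2$ let $\nu_n$ be the empirical measure of the zeros, counted with multiplicity, of the randomized derivative $$Q_n(z)=\sum_{k=1}^n\gamma^{(n)}_k\prod_{1\le j\le n,\ j\ne k}(z-Z^{(n)}_j).$$ If $(\mu_n)_{n\ge1}$ converges almost surely to a deterministic measure $\mu$ on $\mathbb{C}$, then $(\nu_n)_{n\ge2}$ converges almost surely to $\mu$.
   Context: All random variables are defined on one probability space. The Gamma distribution of parameter $\beta/2$ has density $\frac{1}{\Gamma(\beta/2)}t^{\beta/2-1}e^{-t}$ on $(0,\infty)$. The empirical measure of the zeros of a polynomial of degree $d\ge1$ is $\frac1d$ times the sum of the Dirac masses at its zeros, counted with multiplicity (here $Q_n$ has degree $n-1$ almost surely). Almost sure convergence of random probability measures means that, almost surely, the sequence converges weakly (tested against bounded continuous functions on $\mathbb{C}$). *)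

(* Defs.v *)
From HB Require Import structures.
From mathcomp Require Import all_boot all_order all_algebra.
From mathcomp Require Import complex.
From mathcomp Require Import all_classical all_reals all_analysis.

Set Implicit Arguments.
Unset Strict Implicit.
Unset Printing Implicit Defensive.

Import Order.TTheory GRing.Theory Num.Theory.
Import numFieldNormedType.Exports.

Local Open Scope classical_set_scope.
Local Open Scope ring_scope.
Local Open Scope complex_scope.

(* R[i] receives the metric topology of its modulus, which the library attaches
   to every numeric field, and the Borel sigma-algebra of that topology. *)
HB.instance Definition _ (R : realType) :=
  PseudoPointedMetric.copy R[i] (R[i])^o.

HB.instance Definition _ (R : realType) :=
  @isMeasurable.Build (sigma_display (@open R[i])) R[i]
    <<s @open R[i] >> (@sigma_algebra0 _ setT _) (@sigma_algebraC R[i] _)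
    (@sigma_algebra_bigcup _ setT _).

Section gamma_distribution.
Context {R : realType}.
Implicit Types a t : R.

Definition Gamma a : R :=
  \int[lebesgue_measure]_(t in `]0, +oo[) (t `^ (a - 1) * expR (- t)).

Definition gamma_pdf a : R -> R :=
  (fun t => (Gamma a)^-1 * t `^ (a - 1) * expR (- t)) \_ `]0, +oo[.

Definition gamma_prob a (A : set R) : \bar R :=
  (\int[lebesgue_measure]_(t in A) (gamma_pdf a t)%:E)%E.

End gamma_distribution.

Section independence.
Context d (T : measurableType d) (R : realType) (P : probability T R).

(* Subfamilies are covered by taking A i = setT for the other indices. *)
Definition mutually_independent d' (T' : measurableType d') n
    (X : 'I_n -> {RV P >-> T'}) : Prop :=
  forall A : 'I_n -> set T', (forall i, measurable (A i)) ->
    P (\bigcap_i (X i @^-1` A i)) = (\prod_(i < n) P (X i @^-1` A i))%E.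

Definition independent_families d1 (T1 : measurableType d1)
    d2 (T2 : measurableType d2) n1 n2
    (X : 'I_n1 -> {RV P >-> T1}) (Y : 'I_n2 -> {RV P >-> T2}) : Prop :=
  forall A B : set T,
    g_sigma_preimage (fun i => X i : T -> T1) A ->
    g_sigma_preimage (fun j => Y j : T -> T2) B ->
    P (A `&` B) = (P A * P B)%E.

End independence.

Section zeros.
Context {R : realType}.

(* The null measure when s is empty. *)
Definition empirical_measure (s : seq R[i]) : {measure set R[i] -> \bar R} :=
  mscale ((size s)%:R^-1)%:nng (msum (fun k => \d_(s`_k)) (size s)).

(* Zeros listed with multiplicity, for p != 0; junk for p = 0. *)
Definition zeros (p : {poly R[i]}) : seq R[i] :=
  sval (closed_field_poly_normal p).

Definition randomized_derivative n (g : 'I_n -> R) (z : 'I_n -> R[i]) :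
    {poly R[i]} :=
  \sum_(k < n) (g k)%:C *: \prod_(j < n | j != k) ('X - (z j)%:P).

Definition weakly_converges (m : nat -> {measure set R[i] -> \bar R})
    (mu : {measure set R[i] -> \bar R}) : Prop :=
  forall f : R[i] -> R, continuous f -> bounded_fun f ->
    (\int[m n]_z (f z)%:E)%E @[n --> \oo] --> (\int[mu]_z (f z)%:E)%E.

End zeros.

(* Main.v *)
Require Import Defs.
From HB Require Import structures.
From mathcomp Require Import all_boot all_order all_algebra.
From mathcomp Require Import complex.
From mathcomp Require Import all_classical all_reals all_analysis.
From mathcomp Require Import measurable_realfun.
From mathcomp Require Import ring lra zify.
(** Write P for the monic polynomial with roots Z_1, ..., Z_n and Q for its
    randomized derivative.  The idea is that |Q| and |P| agree, up to factors
    that are polynomial in n, at sufficiently many points, so that their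
    logarithmic potentials differ by O(ln n) = o(n); the empirical measures of
    their zeros then have the same weak limits.

    Potential theory is replaced by an elementary averaging argument.  Let
    L_r(u) = ln max(|u|, r) ([logmax]), the mean of ln|u - x| over the circle
    |x| = r.  Replace that circle by the n roots of X^n = l ([mesh]), where l
    is one of 2n levels in [r^n, 2 r^n].  The product of u - x over these roots
    is u^n - l, so the mean of ln|u - x| over the mesh is L_r(u) + O(ln n / n),
    unless u^n is within r^n / 4n of l ([logmax_generic]).  Each u is
    exceptional for at most one level, and only 2n - 1 points u matter, namely
    the points and the zeros: some level is good for all of them
    ([exists_generic]).  Comparing |P| with |Q| on that mesh compares the sums
    of L_r(. - c) over the points and over the zeros ([sum_logmax_zeros]).

    The upper bound of |Q| by |P| on the mesh is deterministic, because a good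
    mesh stays at distance of order r / n^2 from the points.  For the lower
    bound, use for any k
      (x - Z_k) Q(x) = P(x) (g_k + (x - Z_k) \sum_(j != k) g_j / (x - Z_j)).
    The last sum is independent of g_k, and the law of g_k gives small mass to
    short intervals; so with h = n^-p, p large, the bracket has modulus at most
    h with probability O(n^-5) ([anticoncentration_weight],
    [gamma_law_interval]).  A union bound over all k and all O(n^2) points of
    the meshes, and Borel-Cantelli, give the lower bound almost surely
    ([anticoncentration_mesh]).  It is applied to an index k for which Z_k is
    bounded, which exists by tightness.  Doing this for all rational c and r
    gives [ae_sum_logmax_sublinear].

    It remains to pass to bounded continuous test functions.  The bumps
    L_2r - L_r are Lipschitz with compact support, and their translates along a
    fine lattice have an almost constant sum ([sum_bump_lattice]).  Hence linear
    combinations of bumps with rational parameters approximate uniformly every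
    continuous compactly supported function ([uniform_approximation]), and
    tightness of the points does the rest ([weakly_converges_zeros]). *)
Import Order.TTheory GRing.Theory Num.Theory.
Import numFieldNormedType.Exports.
Local Open Scope classical_set_scope.
Local Open Scope ring_scope.
Import Normc.

Set Implicit Arguments.
Unset Strict Implicit.
Unset Printing Implicit Defensive.

Arguments normc : simpl never.

(** * The modulus of complex numbers *)
Section modulus.
Context {R : realType}.
Implicit Types (u v : R[i]) (a : R).

Lemma normc_ge0 u : 0 <= normc u.
Proof. by case: u => a b; exact: sqrtr_ge0. Qed.

Lemma normc_real a : normc (real_complex R a) = `|a|.
Proof. by rewrite /normc /real_complex_def expr0n /= addr0 sqrtr_sqr. Qed.

Lemma normcX u n : normc (u ^+ n) = normc u ^+ n.
Proof.
elim: n => [|n IH]; first by rewrite !expr0 normc1.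
by rewrite !exprS normcM IH.
Qed.

Lemma normc_prod I (s : seq I) (P : pred I) (F : I -> R[i]) :
  normc (\prod_(i <- s | P i) F i) = \prod_(i <- s | P i) normc (F i).
Proof. by rewrite (big_morph _ (@normcM R) (@normc1 R)). Qed.

Lemma ler_normcD u v : normc (u + v) <= normc u + normc v.
Proof. exact: le_normcD. Qed.

Lemma normc_opp u : normc (- u) = normc u.
Proof. exact: normcN. Qed.

Lemma normc_distC u v : normc (u - v) = normc (v - u).
Proof. by rewrite -normc_opp opprB. Qed.

Lemma ler_normc_sum I (s : seq I) (F : I -> R[i]) :
  normc (\sum_(i <- s) F i) <= \sum_(i <- s) normc (F i).
Proof.
elim: s => [|i s IH]; first by rewrite !big_nil normc0.
by rewrite !big_cons (le_trans (ler_normcD _ _))// lerD2l.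
Qed.

Lemma ler_normcB u v : normc u - normc v <= normc (u - v).
Proof. by rewrite lerBlDr -{1}(subrK v u) ler_normcD. Qed.

End modulus.

(** * Logarithmic means over roots of a constant *)
Section mesh.
Context {R : realType}.
Implicit Types (u v x c : R[i]) (r : R).

(** For j < 2n the levels r^n (1 + j / 2n) lie in [r^n, 2 r^n], so their n-th
    roots stay close to the circle of radius r; there are more of them than
    points and zeros together. *)
Definition level n r j : R := r ^+ n * (1 + j%:R / n.*2%:R).

Definition mesh n r j : seq R[i] :=
  zeros ('X^n - (real_complex R (level n r j))%:P).

Definition logmax r u : R := ln (Num.max (normc u) r).

Lemma zerosE (p : {poly R[i]}) :
  p = lead_coef p *: \prod_(z <- zeros p) ('X - z%:P).
Proof. exact: svalP (closed_field_poly_normal p). Qed.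

Lemma horner_zeros (p : {poly R[i]}) x :
  p.[x] = lead_coef p * \prod_(z <- zeros p) (x - z).
Proof.
rewrite {1}[p]zerosE hornerZ horner_prod; congr (_ * _).
by apply: eq_bigr => z _; rewrite hornerXsubC.
Qed.

Lemma size_zeros (p : {poly R[i]}) : p != 0 -> size (zeros p) = (size p).-1.
Proof.
move=> p0; rewrite {2}[p]zerosE size_scale ?lead_coef_eq0//.
by rewrite size_prod_XsubC.
Qed.

Lemma mesh_prod n r j u : (0 < n)%N ->
  \prod_(x <- mesh n r j) (u - x) = u ^+ n - real_complex R (level n r j).
Proof.
move=> n0; have := horner_zeros ('X^n - (real_complex R (level n r j))%:P) u.
by rewrite lead_coefXnsubC// mul1r hornerD hornerN hornerXn hornerC => ->.
Qed.

Lemma size_mesh n r j : (0 < n)%N -> size (mesh n r j) = n.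
Proof.
move=> n0; rewrite size_zeros -?size_poly_eq0 size_XnsubC//.
Qed.

Lemma meshX n r j x : (0 < n)%N -> x \in mesh n r j ->
  x ^+ n = real_complex R (level n r j).
Proof.
move=> n0 xm; apply/eqP; rewrite -subr_eq0 -mesh_prod//.
by rewrite prodf_seq_eq0; apply/hasP; exists x => //=; rewrite subrr.
Qed.

Lemma level_ge n r j : 0 <= r -> r ^+ n <= level n r j.
Proof.
by move=> r0; rewrite ler_peMr ?exprn_ge0// lerDl divr_ge0.
Qed.

Lemma level_le n r j : 0 <= r -> (j < n.*2)%N -> level n r j <= 2 * r ^+ n.
Proof.
move=> r0 jn; rewrite [leRHS]mulrC ler_wpM2l ?exprn_ge0//.
rewrite -[X in _ <= X]/(1 + 1) lerD2l ler_pdivrMr ?ltr0n ?mul1r ?ler_nat; first exact: ltnW.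
exact: leq_ltn_trans jn.
Qed.

(** The bound r^n / 4n is half the gap between consecutive levels: no u can fail
    it for two levels. *)
Definition generic n r j u :=
  r ^+ n / n.*2.*2%:R <= normc (u ^+ n - real_complex R (level n r j)).

(** Pigeonhole: each u rules out at most one of the 2n levels, and there are
    fewer than 2n of them to avoid. *)
Lemma exists_generic n r (s : seq R[i]) : 0 < r -> (size s < n.*2)%N ->
  exists2 j, (j < n.*2)%N & forall u, u \in s -> generic n r j u.
Proof.
move=> r0 sn; apply: contrapT => H.
have n0 : 0 < n.*2%:R :> R by rewrite ltr0n (leq_ltn_trans _ sn).
(* If every level is bad for some member of s, two levels share one. *)
have K (j : 'I_n.*2) : exists i : 'I_(size s), ~~ generic n r j s`_i.
  apply: contrapT => Hj; apply: H; exists j => // u us; apply/negPn/negP => gu.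
  apply: Hj; have iu : (index u s < size s)%N by rewrite index_mem.
  by exists (Ordinal iu); rewrite /= nth_index.
have [f Hf] := choice K.
suff /leq_card : injective f by rewrite !card_ord leqNgt sn.
move=> i j fij; apply/val_inj => /=; apply/eqP/negPn/negP => ij.
have := Hf i; have := Hf j; rewrite -fij /generic -!ltNge.
set v := s`_(f i); set e := _ / _ => hj hi.
have : normc (real_complex R (level n r i - level n r j)) < e + e.
  apply: le_lt_trans (ltrD hi hj); rewrite rmorphB.
  have -> : real_complex R (level n r i) - real_complex R (level n r j) =
    (v ^+ n - real_complex R (level n r j)) - (v ^+ n - real_complex R (level n r i)).
    by ring.
  by rewrite addrC (le_trans (ler_normcD _ _))// normc_opp.
rewrite normc_real /level -mulrBr opprD addrACA subrr add0r -mulrBl normrM ger0_norm ?exprn_ge0 ?ltW//.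
have -> : e + e = r ^+ n / n.*2%:R.
  by rewrite /e -(muln2 n.*2) natrM invfM mulrA -splitr.
rewrite ltNge ler_pM2l ?exprn_gt0//.
rewrite [`|_ / _|]normrM [`|_^-1|]ger0_norm ?invr_ge0 ?(ltW n0)// => /negP; apply.
rewrite ler_peMl ?invr_ge0 ?(ltW n0)//.
case: (ltngtP i j) ij => // ij _.
  by rewrite distrC -natrB 1?ltnW// ger0_norm// ler1n subn_gt0.
by rewrite -natrB 1?ltnW// ger0_norm// ler1n subn_gt0.
Qed.

(** Relative to max(|u|, r)^n: when |u|^n <= 4 r^n this is the genericity
    itself, and for larger |u| the level is at most half of |u|^n. *)
Lemma generic_ge n r j u : (0 < n)%N -> 0 < r -> (j < n.*2)%N ->
  generic n r j u ->
  Num.max (normc u) r ^+ n / (16 * n)%:R <=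
    normc (u ^+ n - real_complex R (level n r j)).
Proof.
move=> n0 r0 jn gu.
have rn : 0 < r ^+ n by rewrite exprn_gt0.
have lr := level_ge n j (ltW r0).
have lr2 := level_le (ltW r0) jn.
have n1 : 1 <= n%:R :> R by rewrite ler1n.
have E : r ^+ n / n.*2.*2%:R = 4 * (r ^+ n / (16 * n)%:R).
  by rewrite -!muln2 !natrM; field; rewrite pnatr_eq0 -lt0n.
have i0 : 0 <= (16 * n)%:R^-1 :> R by rewrite invr_ge0.
have [ur|ur] := lerP (normc u ^+ n) (4 * r ^+ n).
  apply: le_trans gu; rewrite E mulrA ler_wpM2r//.
  by case: (leP (normc u) r) => // _; lra.
have -> : Num.max (normc u) r = normc u.
  apply/max_idPl; rewrite -(ler_pXn2r n0) ?nnegrE ?normc_ge0 ?(ltW r0)//; nra.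
apply: le_trans (ler_normcB _ _); rewrite normcX normc_real ger0_norm; last lra.
suff : normc u ^+ n / (16 * n)%:R <= normc u ^+ n / 2 by lra.
rewrite ler_wpM2l ?exprn_ge0 ?normc_ge0// lef_pV2 ?posrE ?ltr0n ?muln_gt0 ?n0//.
by rewrite ler_nat; lia.
Qed.

Lemma level_dist_le n r j u : (0 < n)%N -> 0 < r -> (j < n.*2)%N ->
  normc (u ^+ n - real_complex R (level n r j)) <=
  Num.max (normc u) r ^+ n * (16 * n)%:R.
Proof.
move=> n0 r0 jn.
have lr := level_ge n j (ltW r0).
have lr2 := level_le (ltW r0) jn.
have rn : 0 < r ^+ n by rewrite exprn_gt0.
have n1 : 1 <= n%:R :> R by rewrite ler1n.
rewrite (le_trans (ler_normcD _ _))// normc_opp normcX normc_real ger0_norm; last lra.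
have h1 : normc u ^+ n <= Num.max (normc u) r ^+ n.
  by rewrite lerXn2r ?nnegrE ?normc_ge0 ?le_max ?lexx// normc_ge0.
have h2 : r ^+ n <= Num.max (normc u) r ^+ n.
  by rewrite lerXn2r ?nnegrE ?(ltW r0)// le_max ?(ltW r0) ?lexx orbT.
rewrite natrM; set M := Num.max _ _ ^+ n in h1 h2 *.
nra.
Qed.

(** On a generic mesh the mean of ln|u - x| is L_r(u), as for the full circle,
    up to a logarithmic error: |u^n - l| and max(|u|, r)^n differ by a factor at
    most 16n both ways. *)
Lemma logmax_generic n r j u : (0 < n)%N -> 0 < r -> (j < n.*2)%N ->
  generic n r j u ->
  `|ln (normc (u ^+ n - real_complex R (level n r j))) - logmax r u *+ n|
    <= ln (16 * n)%:R.
Proof.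
move=> n0 r0 jn gu.
have m0 : 0 < Num.max (normc u) r by rewrite lt_max r0 orbT.
have n16 : 0 < (16 * n)%:R :> R by rewrite ltr0n muln_gt0.
have ge := generic_ge n0 r0 jn gu.
have le := level_dist_le u n0 r0 jn.
have p0 : 0 < normc (u ^+ n - real_complex R (level n r j)).
  by apply: lt_le_trans ge; rewrite divr_gt0 ?exprn_gt0.
rewrite /logmax -lnXn// ler_distl; apply/andP; split.
  by rewrite -ln_div ?posrE ?exprn_gt0// ler_ln ?posrE// divr_gt0 ?exprn_gt0.
by rewrite -lnM ?posrE ?exprn_gt0// ler_ln ?posrE// mulr_gt0 ?exprn_gt0.
Qed.

(** Since x^n - u^n is x - u times a sum of n products of n - 1 factors x or u,
    a lower bound on |x^n - u^n| forces x and u apart. *)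
Lemma dist_mesh n r j u x : (0 < n)%N -> 0 < r -> (j < n.*2)%N ->
  generic n r j u -> x \in mesh n r j -> r / (32 * n ^ 2)%:R <= normc (x - u).
Proof.
move=> n0 r0 jn gu xm.
have ge := generic_ge n0 r0 jn gu.
have xX := meshX n0 xm.
set m := Num.max (normc u) r in ge.
have m0 : 0 < m by rewrite lt_max r0 orbT.
have rn : 0 < r ^+ n by rewrite exprn_gt0.
have n1 : 1 <= n%:R :> R by rewrite ler1n.
have lr := level_ge n j (ltW r0).
have lr2 := level_le (ltW r0) jn.
pose m' := Num.max (normc u) (normc x).
have xn : normc x ^+ n = level n r j by rewrite -normcX xX normc_real ger0_norm//; lra.
have rx : r <= normc x by rewrite -(ler_pXn2r n0) ?nnegrE ?normc_ge0 ?(ltW r0)// xn.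
have m'r : r <= m' by rewrite /m' le_max rx orbT.
have m'0 : 0 < m' by exact: lt_le_trans m'r.
have m'm : m' ^+ n <= 2 * m ^+ n.
  rewrite /m'; case: (leP (normc u) (normc x)) => _.
    rewrite xn (le_trans lr2)// ler_pM2l// lerXn2r ?nnegrE ?(ltW r0) ?(ltW m0)//.
    by rewrite /m le_max lexx orbT.
  have : normc u ^+ n <= m ^+ n.
    by rewrite lerXn2r ?nnegrE ?normc_ge0 ?(ltW m0)// /m le_max lexx.
  by have := exprn_gt0 n m0; lra.
have up : normc (u ^+ n - x ^+ n) <= normc (x - u) * (n%:R * m' ^+ n.-1).
  rewrite subrXX normcM normc_distC ler_wpM2l ?normc_ge0//.
  rewrite (le_trans (ler_normc_sum _ _))//.
  rewrite mulr_natl -[X in _ *+ X]card_ord -sumr_const; apply: ler_sum => i _.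
  rewrite normcM !normcX.
  have -> : m' ^+ n.-1 = m' ^+ (n.-1 - i) * m' ^+ i.
    by rewrite -exprD subnK// -ltnS prednK.
  by rewrite ler_pM ?exprn_ge0 ?normc_ge0// lerXn2r ?nnegrE ?normc_ge0 ?(ltW m'0)// /m' le_max lexx ?orbT.
rewrite xX in up; have H := le_trans ge up.
have E : m' ^+ n = m' * m' ^+ n.-1 by rewrite -exprS prednK.
have q0 := exprn_gt0 n.-1 m'0.
rewrite -(ler_pM2r (mulr_gt0 (lt_le_trans ltr01 n1) q0)); apply: le_trans H.
have -> : r / (32 * n ^ 2)%:R * (n%:R * m' ^+ n.-1) = (r * m' ^+ n.-1 / 2) / (16 * n)%:R.
  by rewrite expnS expn1 !natrM; field; rewrite pnatr_eq0 -lt0n.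
rewrite ler_wpM2r ?invr_ge0//.
nra.
Qed.

Lemma ln_prod_seq (I : eqType) (s : seq I) (F : I -> R) :
  (forall i, i \in s -> 0 < F i) ->
  ln (\prod_(i <- s) F i) = \sum_(i <- s) ln (F i).
Proof.
elim: s => [|i s IH] Fs; first by rewrite !big_nil ln1.
rewrite !big_cons lnM ?posrE ?IH//.
- by move=> k ks; rewrite Fs// inE ks orbT.
- by rewrite Fs// mem_head.
- by rewrite big_seq prodr_gt0// => k ks; rewrite Fs// inE ks orbT.
Qed.

(** Exchanging the products over the mesh and over s turns the values at the mesh
    points into the explicit quantities |(u - c)^n - l|. *)
Lemma mesh_mean n r c j A (s : seq R[i]) : (0 < n)%N -> 0 < r -> 0 < A ->
  (forall u, u \in s -> generic n r j (u - c)) ->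
  0 < \prod_(x <- mesh n r j) (A * \prod_(u <- s) normc (c + x - u)) /\
  ln (\prod_(x <- mesh n r j) (A * \prod_(u <- s) normc (c + x - u))) =
  ln A *+ n +
    \sum_(u <- s) ln (normc ((u - c) ^+ n - real_complex R (level n r j))).
Proof.
move=> n0 r0 A0 gs.
have g0 u : u \in s -> 0 < normc ((u - c) ^+ n - real_complex R (level n r j)).
  move=> /gs; apply: lt_le_trans.
  by rewrite divr_gt0 ?exprn_gt0// ltr0n -!muln2 !muln_gt0 n0.
have -> : \prod_(x <- mesh n r j) (A * \prod_(u <- s) normc (c + x - u)) =
    A ^+ n * \prod_(u <- s) normc ((u - c) ^+ n - real_complex R (level n r j)).
  rewrite big_split /= big_const_seq count_predT size_mesh// iter_mulr_1; congr (_ * _).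
  rewrite exchange_big /=; apply: eq_bigr => u _.
  rewrite -mesh_prod// normc_prod; apply: eq_bigr => x _.
  by rewrite normc_distC; congr normc; ring.
have p0 : 0 < \prod_(u <- s) normc ((u - c) ^+ n - real_complex R (level n r j)).
  by rewrite big_seq prodr_gt0.
split; first by rewrite mulr_gt0 ?exprn_gt0.
by rewrite lnM ?posrE ?exprn_gt0// lnXn// ln_prod_seq.
Qed.

(** A pointwise comparison of two polynomials on a generic mesh, given by their
    leading coefficients A, B and roots s, t, compares the sums of L_r over their
    roots: take logarithms and average over the mesh. *)
Lemma ler_sum_logmax n r c j A B (s t : seq R[i]) : (0 < n)%N -> 0 < r ->
  (j < n.*2)%N -> 0 < A -> 0 < B -> (size s <= n)%N -> (size t <= n)%N ->
  (forall u, u \in s ++ t -> generic n r j (u - c)) ->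
  (forall x, x \in mesh n r j -> A * \prod_(u <- s) normc (c + x - u) <=
                                  B * \prod_(u <- t) normc (c + x - u)) ->
  ln A + \sum_(u <- s) logmax r (u - c) <=
  ln B + \sum_(u <- t) logmax r (u - c) + 2 * ln (16 * n)%:R.
Proof.
move=> n0 r0 jn A0 B0 sn tn gst H.
have gs u : u \in s -> generic n r j (u - c).
  by move=> us; apply: gst; rewrite mem_cat us.
have gt u : u \in t -> generic n r j (u - c).
  by move=> ut; apply: gst; rewrite mem_cat ut orbT.
have [ps es] := mesh_mean n0 r0 A0 gs; have [pt et] := mesh_mean n0 r0 B0 gt.
have L0 : 0 <= ln (16 * n)%:R :> R by rewrite ln_ge0// ler1n muln_gt0.
have le : ln A *+ n +
    \sum_(u <- s) ln (normc ((u - c) ^+ n - real_complex R (level n r j))) <=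
   ln B *+ n +
    \sum_(u <- t) ln (normc ((u - c) ^+ n - real_complex R (level n r j))).
  rewrite -es -et ler_ln ?posrE// !big_seq ler_prod// => x xm.
  rewrite H// mulr_ge0 ?(ltW A0)// prodr_ge0// => u _; exact: normc_ge0.
have cmp (l : seq R[i]) : (size l <= n)%N ->
    (forall u, u \in l -> generic n r j (u - c)) ->
    `|\sum_(u <- l) ln (normc ((u - c) ^+ n - real_complex R (level n r j))) -
      (\sum_(u <- l) logmax r (u - c)) *+ n| <= ln (16 * n)%:R *+ n.
  move=> ll gl; rewrite -sumrMnl -sumrB (le_trans (ler_norm_sum _ _ _))//.
  rewrite big_seq (le_trans (ler_sum _ (fun u ul => logmax_generic n0 r0 jn (gl u ul))))//.
  by rewrite -big_seq big_const_seq count_predT iter_addr_0 ler_wpMn2l.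
have := cmp _ sn gs; have := cmp _ tn gt; rewrite !ler_norml => /andP[a1 a2] /andP[b1 b2].
rewrite -(ler_pMn2r n0) !mulrnDl mulr_natl [in leRHS]mulrnAC mulr2n.
lra.
Qed.

End mesh.

(** * Zeros of the randomized derivative *)
Section randomized_derivative.
Context {R : realType}.
Variables (n : nat) (g : 'I_n -> R) (z : 'I_n -> R[i]).
Hypotheses (n_gt0 : (0 < n)%N) (g_gt0 : forall k, 0 < g k).
Let Q := randomized_derivative g z.

Lemma sum_weights_gt0 : 0 < \sum_k g k.
Proof.
rewrite (bigD1 (Ordinal n_gt0))//= ltr_wpDr// sumr_ge0// => i _; exact: ltW.
Qed.

Let term k := \prod_(j < n | j != k) ('X - (z j)%:P).

Let size_term k : size (term k) = n.
Proof.
rewrite /term -big_filter size_prod_XsubC.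
have -> : size [seq j <- index_enum 'I_n | j != k] = #|predC1 k|.
  by rewrite cardE; congr size; rewrite enumT.
by rewrite cardC1 card_ord prednK.
Qed.

Let lead_term k : (term k)`_n.-1 = 1.
Proof.
by have /monicP := monic_prod_XsubC (index_enum 'I_n) (fun j => j != k) z; rewrite /lead_coef size_term.
Qed.

Lemma randomized_derivative_lead :
  size Q = n /\ lead_coef Q = real_complex R (\sum_k g k).
Proof.
have c : Q`_n.-1 = real_complex R (\sum_k g k).
  rewrite coef_sum rmorph_sum; apply: eq_bigr => k _.
  by rewrite coefZ lead_term mulr1.
have le : (size Q <= n)%N.
  rewrite (leq_trans (size_sum _ _ _))//; apply/bigmax_leqP => k _.
  by rewrite (leq_trans (size_scale_leq _ _))// size_term.
have sQ : size Q = n.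
  apply/eqP; rewrite eqn_leq le leqNgt; apply/negP => lt.
  have := sum_weights_gt0; rewrite lt_neqAle => /andP[/negP[]].
  have : Q`_n.-1 = 0 by rewrite nth_default// -ltnS prednK.
  by rewrite c => /eqP; rewrite fmorph_eq0 eq_sym.
by rewrite /lead_coef sQ.
Qed.

Lemma size_zeros_randomized_derivative : size (zeros Q) = n.-1.
Proof.
have [sQ _] := randomized_derivative_lead.
by rewrite size_zeros ?sQ// -size_poly_eq0 sQ -lt0n.
Qed.

Lemma normc_randomized_derivative x :
  normc Q.[x] = (\sum_k g k) * \prod_(w <- zeros Q) normc (x - w).
Proof.
have [_ lQ] := randomized_derivative_lead.
rewrite horner_zeros lQ normcM normc_prod normc_real ger0_norm//.
exact/ltW/sum_weights_gt0.
Qed.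

Lemma horner_randomized_derivative x : Q.[x] =
  \sum_k real_complex R (g k) * \prod_(j < n | j != k) (x - z j).
Proof.
rewrite horner_sum; apply: eq_bigr => k _; rewrite hornerZ horner_prod.
by congr (_ * _); apply: eq_bigr => j _; rewrite hornerXsubC.
Qed.

(** Each term of Q(x) is P(x) g_k / (x - z_k). *)
Lemma randomized_derivative_le x e : 0 < e -> (forall k, e <= normc (x - z k)) ->
  normc Q.[x] <= (\sum_k g k) / e * \prod_k normc (x - z k).
Proof.
move=> e0 xz; rewrite horner_randomized_derivative (le_trans (ler_normc_sum _ _))//.
rewrite mulr_suml mulr_suml; apply: ler_sum => k _.
rewrite normcM normc_real gtr0_norm// normc_prod [X in _ <= _ * X](bigD1 k)//= mulrA.
rewrite ler_wpM2r ?prodr_ge0// => [j _|]; first exact: normc_ge0.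
by rewrite -mulrA ler_peMr ?(ltW (g_gt0 k))// mulrC ler_pdivlMr// mul1r.
Qed.

(** The lower bound on |Q| is assumed on all meshes, since the good level depends
    on the zeros of Q.  The upper bound needs no assumption: a mesh that is generic
    for the points z_k stays at distance r / 32n^2 from them. *)
Theorem sum_logmax_zeros r c eta : 0 < r -> 0 < eta ->
  (forall j x, (j < n.*2)%N -> x \in mesh n r j ->
     eta * \prod_k normc (c + x - z k) <= normc Q.[c + x]) ->
  `|\sum_(w <- zeros Q) logmax r (w - c) - \sum_k logmax r (z k - c)| <=
  Num.max (ln (\sum_k g k) - ln eta) (ln ((32 * n ^ 2)%:R / r)) + 2 * ln (16 * n)%:R.
Proof.
move=> r0 eta0 H.
pose s := [seq z k | k <- index_enum 'I_n]; pose t := zeros Q.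
have G0 := sum_weights_gt0.
have ss : size s = n by rewrite size_map /index_enum -enumT size_enum_ord.
have st : (size t < n)%N by rewrite size_zeros_randomized_derivative prednK.
(* n points and n - 1 zeros: one less than the number of levels. *)
have sst : (size (map (fun u => u - c)%R (s ++ t)) < n.*2)%N.
  by rewrite size_map size_cat ss -addnn ltn_add2l.
have [j jn gj] := exists_generic r0 sst.
have gst u : u \in s ++ t -> generic n r j (u - c).
  by move=> us; apply: gj; apply: map_f.
have gts u : u \in t ++ s -> generic n r j (u - c).
  by rewrite mem_cat orbC -mem_cat; exact: gst.
have d0 : 0 < (32 * n ^ 2)%:R :> R by rewrite ltr0n muln_gt0 expn_gt0 n_gt0.
have low : ln eta + \sum_(u <- s) logmax r (u - c) <=
    ln (\sum_k g k) + \sum_(u <- t) logmax r (u - c) + 2 * ln (16 * n)%:R.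
  apply: (ler_sum_logmax n_gt0 r0 jn eta0 G0 _ _ gst); rewrite ?ss ?(ltnW st)//.
  by move=> x xm; rewrite -normc_randomized_derivative /s big_map; exact: (H j).
have upp : ln (\sum_k g k) + \sum_(u <- t) logmax r (u - c) <=
    ln ((\sum_k g k) / (r / (32 * n ^ 2)%:R)) + \sum_(u <- s) logmax r (u - c) + 2 * ln (16 * n)%:R.
  apply: (ler_sum_logmax n_gt0 r0 jn G0 _ _ _ gts); rewrite ?ss ?(ltnW st)//.
    by rewrite divr_gt0// divr_gt0.
  move=> x xm; rewrite -normc_randomized_derivative /s big_map.
  apply: randomized_derivative_le; first by rewrite divr_gt0.
  move=> k; have -> : c + x - z k = x - (z k - c) by ring.
  apply: (dist_mesh n_gt0 r0 jn) => //; apply: gst.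
  by rewrite mem_cat map_f// mem_index_enum.
rewrite lnM ?posrE ?invr_gt0 ?divr_gt0// invf_div in upp.
rewrite /s !big_map in low upp.
set X := \sum_(w <- zeros Q) _; set Y := \sum_k logmax _ _.
rewrite -/X -/Y in low upp *.
set M := Num.max _ _.
have m1 : ln (\sum_k g k) - ln eta <= M by rewrite le_max lexx.
have m2 : ln ((32 * n ^ 2)%:R / r) <= M by rewrite le_max lexx orbT.
rewrite ler_norml; apply/andP; split; lra.
Qed.

End randomized_derivative.

(** * Independence and anti-concentration *)
Section independence_sigma.
Context d (T : measurableType d) (R : realType) (P : probability T R).
Local Open Scope ereal_scope.

(** Dynkin's pi-lambda theorem, for independence from one event A. *)
Lemma independence_dynkin (A : set T) (G : set (set T)) :
  measurable A -> setI_closed G ->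
  (forall B, G B -> measurable B /\ P (A `&` B) = P A * P B) ->
  forall B, <<s G >> B -> measurable B /\ P (A `&` B) = P A * P B.
Proof.
move=> mA GI GP B sB.
pose D := [set C | measurable C /\ P (A `&` C) = P A * P C].
suff : <<s G >> `<=` D by apply.
apply: lambda_system_subset => //; apply/dynkin_lambda_system; split.
- by split => //; rewrite setIT probability_setT mule1.
- move=> C [mC PC]; split; first exact: measurableC.
  have PA : P A < +oo by rewrite (le_lt_trans (probability_le1 P mA))// ltry.
  transitivity (P A - P (A `&` C)); first by rewrite -setDE; exact: measureD.
  rewrite PC probability_setC//.
  rewrite muleBr ?mule1 ?fin_num_measure//.
- move=> F tF DF.
  have mF i : measurable (F i) by case: (DF i).
  split; first exact: bigcupT_measurable.
  rewrite setI_bigcupr measure_semi_bigcup//; first last.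
  - by apply: bigcupT_measurable => i; exact: measurableI.
  - exact: trivIset_setIl.
  - by move=> i; exact: measurableI.
  rewrite measure_semi_bigcup//; last exact: bigcupT_measurable.
  have [p pE] : exists p : R, P A = p%:E.
    by exists (fine (P A)); rewrite fineK// fin_num_measure.
  rewrite pE -nneseriesZl//; apply: eq_eseriesr => i _.
  by have [_ H] := DF i; rewrite -pE; exact: H.
Qed.

(** Conditioning on V without conditional laws: cut the line into cells of
    length h.  On the event that V lies in a given cell, |X - V| <= h puts X in a
    fixed interval of length 3h, an event independent of that cell. *)
Lemma anticoncentration_independent (X V : T -> R) (h e : R) :
  (0 < h)%R -> (0 <= e)%R ->
  measurable_fun setT X -> measurable_fun setT V ->
  (forall I J, measurable I -> measurable J ->
     P (X @^-1` J `&` V @^-1` I) = P (X @^-1` J) * P (V @^-1` I)) ->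
  (forall u, P (X @^-1` `[u, (u + 3 * h)%R]%classic) <= e%:E) ->
  P [set w | `|X w - V w| <= h]%R <= e%:E.
Proof.
move=> h0 e0 mX mV XV Xe.
have mE : measurable [set w | `|X w - V w| <= h]%R.
  have -> : [set w | `|X w - V w| <= h]%R = (fun w => `|X w - V w|)%R @^-1` `]-oo, h].
    by apply/seteqP; split => w /=; rewrite in_itv.
  rewrite -[X in measurable X]setTI; apply: measurableT_comp => //.
  exact: measurable_funB.
pose cell (m : int) := `[(m%:~R * h)%R, ((m + 1)%:~R * h)%R[%classic.
have mVI J : measurable J -> measurable (V @^-1` J).
  by move=> mJ; rewrite -[X in measurable X]setTI; exact: mV.
have mXI J : measurable J -> measurable (X @^-1` J).
  by move=> mJ; rewrite -[X in measurable X]setTI; exact: mX.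
have VI w : cell (Num.floor ((V w / h)%R)) (V w).
  rewrite /cell /= in_itv /= -ler_pdivlMr// -ltr_pdivrMr//.
  by rewrite Num.Theory.floor_le Num.Theory.floorD1_gt.
have Im m w : cell m (V w) -> m = Num.floor ((V w / h)%R).
  rewrite /cell /= in_itv /= -ler_pdivlMr// -ltr_pdivrMr// => H.
  by apply/esym/eqP; rewrite Num.Theory.floor_eq.
(* The cells are re-indexed by natural numbers, with empty sets as padding. *)
have [D [mD tD cD eD]] : exists D : nat -> set T,
    [/\ forall k, measurable (D k), trivIset setT D, forall w, exists k, D k w &
        forall k, D k = set0 \/ exists m, D k = V @^-1` cell m].
  pose D k := if @pickle_inv int k is Some m then V @^-1` cell m else set0.
  exists D; split.
  - move=> k; rewrite /D; case: pickle_inv => [m|//].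
    by apply: mVI; exact: measurable_itv.
  - have Dk k w : D k w -> k = pickle (Num.floor (V w / h)%R).
      rewrite /D; have := @pickle_invK int k.
      by case: (pickle_inv k) => [m|//] /= E /Im <-.
    apply/trivIsetP => k l _ _ /eqP kl; apply/seteqP; split; last exact: sub0set.
    by move=> w [/Dk Ek /Dk El]; apply: kl; rewrite Ek El.
  - move=> w; exists (pickle (Num.floor (V w / h)%R)).
    by rewrite /D pickleK_inv; exact: VI.
  - by move=> k; rewrite /D; case: pickle_inv => [m|]; [right; exists m|left].
have ED : [set w | `|X w - V w| <= h]%R `<=`
    \bigcup_k ([set w | `|X w - V w| <= h]%R `&` D k).
  by move=> w Ew; have [k Dk] := cD w; exists k.
apply: le_trans (measure_sigma_subadditive _ _ mE ED) _ => //.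
  by move=> k; exact: measurableI.
have le k : P ([set w | `|X w - V w| <= h]%R `&` D k) <= e%:E * P (D k).
  have [DE|[m DE]] := eD k.
    by rewrite DE setI0 measure0 mule0.
  rewrite DE.
  apply: (@le_trans _ _ (P (X @^-1` `[((m - 1)%:~R * h)%R, ((m - 1)%:~R * h + 3 * h)%R]%classic `&` V @^-1` cell m))).
    apply: le_measure; rewrite ?inE.
    - by apply: measurableI => //; apply: mVI; exact: measurable_itv.
    - by apply: measurableI; [apply: mXI|apply: mVI]; exact: measurable_itv.
    - move=> w /= [Ew Iw]; split => //; move: Ew Iw; rewrite /cell /= !in_itv /=.
      rewrite ler_norml rmorphB rmorphD /= => /andP[a b] /andP[c dd].
      by apply/andP; split; lra.
  apply: le_trans (lee_wpmul2r _ (Xe ((m - 1)%:~R * h)%R)); last exact: measure_ge0.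
  rewrite le_eqVlt; apply/orP; left; apply/eqP; apply: XV; exact: measurable_itv.
apply: (@le_trans _ _ (\sum_(k <oo) (e%:E * P (D k)))).
  by apply: lee_nneseries => [k _ _|k _]; [exact: measure_ge0|exact: le].
rewrite nneseriesZl// -measure_semi_bigcup//; last exact: bigcupT_measurable.
rewrite -[leRHS]mule1 lee_wpmul2l ?lee_fin//.
by apply: probability_le1; exact: bigcupT_measurable.
Qed.

End independence_sigma.

(** * Measurability and topology of the complex plane *)
Section complex_measurability.
Context d (T : measurableType d) (R : realType).
Implicit Types u v : T -> R[i].

(** Coordinatewise measurability passes through the field operations by the real
    case. *)
Definition cmeasurable u :=
  measurable_fun setT (fun w => complex.Re (u w)) /\ measurable_fun setT (fun w => complex.Im (u w)).

Lemma cmeasurable_cst (c : R[i]) : cmeasurable (fun=> c).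
Proof. by split; exact: measurable_cst. Qed.

Lemma cmeasurable_real (f : T -> R) : measurable_fun setT f ->
  cmeasurable (fun w => real_complex R (f w)).
Proof. by move=> mf; split => //; exact: measurable_cst. Qed.

Lemma cmeasurableD u v : cmeasurable u -> cmeasurable v ->
  cmeasurable (fun w => u w + v w).
Proof.
move=> [ur ui] [vr vi]; split.
  under eq_fun => w do rewrite raddfD /=; exact: measurable_funD.
under eq_fun => w do rewrite raddfD /=; exact: measurable_funD.
Qed.

Lemma cmeasurableB u v : cmeasurable u -> cmeasurable v ->
  cmeasurable (fun w => u w - v w).
Proof.
move=> [ur ui] [vr vi]; split.
  under eq_fun => w do rewrite raddfB; exact: measurable_funB.
under eq_fun => w do rewrite raddfB; exact: measurable_funB.
Qed.

Lemma ReM (a b : R[i]) : complex.Re (a * b) = complex.Re a * complex.Re b - complex.Im a * complex.Im b.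
Proof. by case: a; case: b. Qed.

Lemma ImM (a b : R[i]) : complex.Im (a * b) = complex.Re a * complex.Im b + complex.Im a * complex.Re b.
Proof. by case: a; case: b. Qed.

Lemma cmeasurableM u v : cmeasurable u -> cmeasurable v ->
  cmeasurable (fun w => u w * v w).
Proof.
move=> [ur ui] [vr vi]; split.
  under eq_fun => w do rewrite ReM.
  by apply: measurable_funB; exact: measurable_funM.
under eq_fun => w do rewrite ImM.
by apply: measurable_funD; exact: measurable_funM.
Qed.

Lemma Re_inv (a : R[i]) : complex.Re a^-1 = complex.Re a * (complex.Re a ^+ 2 + complex.Im a ^+ 2)^-1.
Proof. by case: a. Qed.

Lemma Im_inv (a : R[i]) : complex.Im a^-1 = - complex.Im a * (complex.Re a ^+ 2 + complex.Im a ^+ 2)^-1.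
Proof. by case: a => a b /=; rewrite mulNr. Qed.

Lemma cmeasurableV u : cmeasurable u -> cmeasurable (fun w => (u w)^-1).
Proof.
move=> [ur ui].
have mq : measurable_fun setT (fun w => (complex.Re (u w) ^+ 2 + complex.Im (u w) ^+ 2)^-1).
  under eq_fun => w do rewrite -powR_inv1 ?addr_ge0 ?sqr_ge0//.
  apply: (@measurableT_comp _ _ _ _ _ _ (@powR R ^~ (-1))).
    exact: measurable_powR.
  by apply: measurable_funD; exact: measurable_funX.
split.
  by under eq_fun => w do rewrite Re_inv; exact: measurable_funM.
under eq_fun => w do rewrite Im_inv; apply: measurable_funM => //.
exact: measurableT_comp.
Qed.

Lemma cmeasurable_sum I (s : seq I) (Q : pred I) (F : I -> T -> R[i]) :
  (forall i, cmeasurable (F i)) ->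
  cmeasurable (fun w => \sum_(i <- s | Q i) F i w).
Proof.
move=> mF; elim: s => [|i s IH].
  by under eq_fun => w do rewrite big_nil; exact: cmeasurable_cst.
under eq_fun => w do rewrite big_cons.
by case: (Q i) => //; exact: cmeasurableD.
Qed.

End complex_measurability.

Section complex_topology.
Context {R : realType}.

Lemma normr_normc (u : R[i]) : `|u| = real_complex R (normc u).
Proof. by rewrite normc_def; case: u. Qed.

Lemma nbhs_normc (z : R[i]) (A : set R[i]) :
  nbhs z A <-> exists2 e : R, 0 < e & forall y, normc (z - y) < e -> A y.
Proof.
split.
  move=> /nbhs_ballP[e /= e0 H]; exists (complex.Re e).
    by move: e0; rewrite ltcE /= => /andP[].
  move=> y zy; apply: H; rewrite /ball /=.
  move: e0; rewrite ltcE /= => /andP[/eqP ie _].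
  have -> : e = real_complex R (complex.Re e) by case: e ie {zy} => a b /= ->.
  by rewrite normr_normc ltcR.
move=> [e e0 H]; apply/nbhs_ballP; exists (real_complex R e) => /=.
  by rewrite ltcR.
by move=> y; rewrite /ball /= normr_normc ltcR => ?; exact: H.
Qed.

Lemma continuous_normcP (f : R[i] -> R) : continuous f <->
  forall z e, 0 < e -> exists2 dl : R, 0 < dl & forall y, normc (z - y) < dl -> `|f z - f y| < e.
Proof.
split=> [cf z e e0|H z].
  have := cf z; move/cvgrPdist_lt => /(_ _ e0) => /nbhs_normc[dl dl0 Hd].
  by exists dl.
move=> A /nbhs_ballP[e /= e0 eA]; apply/nbhs_normc.
by have [dl dl0 Hd] := H z e e0; exists dl => // y /Hd ?; exact: eA.
Qed.

Lemma ler_Re_normc (u : R[i]) : `|complex.Re u| <= normc u.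
Proof. by have := normc_ge_Re u; rewrite normr_normc lecR. Qed.

Lemma ler_Im_normc (u : R[i]) : `|complex.Im u| <= normc u.
Proof.
by case: u => a b; rewrite /normc /= -sqrtr_sqr ler_wsqrtr// lerDr sqr_ge0.
Qed.

Lemma continuous_Re : continuous (@complex.Re R : R[i] -> R).
Proof.
apply/continuous_normcP => z e e0; exists e => // y; apply: le_lt_trans.
by rewrite -raddfB; exact: ler_Re_normc.
Qed.

Lemma continuous_Im : continuous (@complex.Im R : R[i] -> R).
Proof.
apply/continuous_normcP => z e e0; exists e => // y; apply: le_lt_trans.
by rewrite -raddfB; exact: ler_Im_normc.
Qed.

(** The sigma-algebra of the plane is the Borel one, and that of the line is
    generated by open intervals. *)
Lemma continuous_complex_measurable (f : R[i] -> R) : continuous f ->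
  measurable_fun setT f.
Proof.
move=> /continuousP cf; apply: (measurability _ (RGenOpens.measurableE R)).
move=> _ [_ [a [b ->] <-]]; rewrite setTI; apply: sub_sigma_algebra.
exact/cf/interval_open.
Qed.

Lemma cmeasurable_RV d (T : measurableType d) (f : T -> R[i]) :
  measurable_fun setT f -> cmeasurable f.
Proof.
move=> mf; split; apply: (measurableT_comp _ mf); apply: continuous_complex_measurable.
- exact: continuous_Re.
- exact: continuous_Im.
Qed.

End complex_topology.

(** * One weight is independent of the rest *)
Section weights_independence.
Context d (T : measurableType d) (R : realType) (P : probability T R).
Variables (n : nat) (g : 'I_n -> {RV P >-> R}) (Z : 'I_n -> {RV P >-> R[i]}).
Hypothesis g_indep : mutually_independent g.
Hypothesis gZ_indep : independent_families g Z.
Variable k : 'I_n.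
Local Open Scope ereal_scope.

(** A pi-system generating the sigma-algebra of all the points and of all the
    weights except the k-th: the condition A k = setT removes g_k. *)
Definition other_cylinders : set (set T) := [set C | exists A : 'I_n -> set R,
  [/\ forall i, measurable (A i), A k = setT & exists2 B,
    g_sigma_preimage (fun j => Z j : T -> R[i]) B &
    C = \bigcap_i (g i @^-1` A i) `&` B]].

Lemma other_cylinders_setI : setI_closed other_cylinders.
Proof.
move=> C D [A [mA Ak [B sB ->]]] [A' [mA' A'k [B' sB' ->]]].
exists (fun i => A i `&` A' i); split.
- by move=> i; exact: measurableI.
- by rewrite Ak A'k setIT.
exists (B `&` B').
  exact: (@measurableI _ (g_sigma_algebraType
    (\big[setU/set0]_(i < n) preimage_set_system setT (Z i) measurable)) B B').
apply/seteqP; split => w /=.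
  by move=> [[H1 H2] [H3 H4]]; split => // i _; split; [exact: H1|exact: H3].
by move=> [H1 [H2 H3]]; split; split=> // i; have [] := H1 i Logic.I.
Qed.

Let g_sigma (A : 'I_n -> set R) : (forall i, measurable (A i)) ->
  g_sigma_preimage (fun j => g j : T -> R) (\bigcap_i (g i @^-1` A i)).
Proof.
move=> mA.
apply: (@fin_bigcap_measurable _ (g_sigma_algebraType
    (\big[setU/set0]_(i < n) preimage_set_system setT (g i) measurable))) => //.
move=> i _; apply: sub_sigma_algebra; rewrite -bigcup_seq/=.
exists i; first by rewrite /= mem_index_enum.
by exists (A i) => //; rewrite setTI.
Qed.

Let Z_sigma_measurable B : g_sigma_preimage (fun j => Z j : T -> R[i]) B -> measurable B.
Proof.
apply: smallest_sub; first exact: sigma_algebra_measurable.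
rewrite -bigcup_seq => C [i _ [A mA <-]]; exact: measurable_funP.
Qed.

(** Adding the event g_k \in J to a cylinder only replaces its k-th side, so both
    independence hypotheses apply to cylinders. *)
Lemma other_cylinders_independence J B : measurable J -> other_cylinders B ->
  measurable B /\ P (g k @^-1` J `&` B) = P (g k @^-1` J) * P B.
Proof.
move=> mJ [A [mA Ak [B' sB' ->]]].
have mgi i C : measurable C -> measurable (g i @^-1` C).
  by move=> mC; rewrite -[X in measurable X]setTI; exact: measurable_funP.
have mB' := Z_sigma_measurable sB'.
split.
  by apply: measurableI => //; apply: fin_bigcap_measurable => // i _; exact: mgi.
pose A' i := if i == k then J else A i.
have mA' i : measurable (A' i) by rewrite /A'; case: ifP.
have -> : g k @^-1` J `&` (\bigcap_i (g i @^-1` A i) `&` B') =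
          \bigcap_i (g i @^-1` A' i) `&` B'.
  rewrite setIA; congr (_ `&` _); apply/seteqP; split => w /=.
    move=> [H1 H2] i _; rewrite /A'; case: ifPn => [/eqP -> //|_]; exact: H2.
  move=> H; split; first by have := H k Logic.I; rewrite /A' eqxx.
  move=> i _; have := H i Logic.I; rewrite /A'; case: ifPn => [/eqP ->|//].
  by rewrite Ak.
rewrite (gZ_indep (g_sigma mA') sB') (gZ_indep (g_sigma mA) sB').
rewrite muleA; congr (_ * _).
rewrite g_indep// g_indep// (bigD1 k)//= [X in _ = _ * X](bigD1 k)//=.
rewrite Ak preimage_setT probability_setT mul1e {1}/A' eqxx; congr (_ * _).
by apply: eq_bigr => i /negPf ik; rewrite /A' ik.
Qed.

(** The factor (x - Z_k) Q(x) / P(x) is g_k plus a complex number that depends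
    only on the other weights and on the points.  Its modulus is at least that of
    its real part, which is g_k - other_weights x. *)
Definition other_weights (x : R[i]) (w : T) : R :=
  (- complex.Re ((x - Z k w) * \sum_(j < n | j != k) real_complex R (g j w) / (x - Z j w)))%R.

(* T with the smaller sigma-algebra, for which other_weights is measurable. *)
Let S := g_sigma_algebraType other_cylinders.

Let weight_measurable j : j != k -> measurable_fun setT (g j : S -> R).
Proof.
move=> jk _ A mA; rewrite setTI; apply: sub_sigma_algebra.
exists (fun i => if i == j then A else setT); split.
- by move=> i; case: ifP.
- by rewrite eq_sym (negPf jk).
exists setT; first exact: (@measurableT _ (g_sigma_algebraType
    (\big[setU/set0]_(i < n) preimage_set_system setT (Z i) measurable))).
rewrite setIT; apply/seteqP; split => w /=.
  by move=> Aw i _; case: ifPn => // /eqP ->.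
by move=> /(_ j Logic.I); rewrite eqxx.
Qed.

Let point_measurable j : measurable_fun setT (Z j : S -> R[i]).
Proof.
move=> _ A mA; rewrite setTI; apply: sub_sigma_algebra.
exists (fun=> setT); split => //; exists (Z j @^-1` A).
  apply: sub_sigma_algebra; rewrite -bigcup_seq/=.
  exists j; first by rewrite /= mem_index_enum.
  by exists A => //; rewrite setTI.
by apply/seteqP; split => w //= [].
Qed.

Let other_weights_measurable_sigma x : measurable_fun setT (other_weights x : S -> R).
Proof.
have mxZ j : cmeasurable (fun w : S => x - Z j w)%R.
  apply: cmeasurableB; first exact: cmeasurable_cst.
  apply: cmeasurable_RV; exact: point_measurable.
suff [] : cmeasurable (fun w : S => (x - Z k w) *
    \sum_(j < n | j != k) real_complex R (g j w) / (x - Z j w))%R.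
  by move=> mre _; exact: measurableT_comp.
apply: cmeasurableM => //.
pose F j (w : S) := if j != k then (real_complex R (g j w) / (x - Z j w))%R else 0%R.
have -> : (fun w : S => \sum_(j < n | j != k) real_complex R (g j w) / (x - Z j w))%R =
    (fun w => \sum_(j < n) F j w)%R.
  by apply/funext => w; rewrite big_mkcond.
apply: cmeasurable_sum => j; rewrite /F.
have [jk|_] := boolP (j != k); last exact: cmeasurable_cst.
apply: cmeasurableM; last exact: cmeasurableV.
apply: cmeasurable_real; exact: weight_measurable.
Qed.

Let sigma_indep J B : measurable J -> <<s other_cylinders >> B ->
  measurable B /\ P (g k @^-1` J `&` B) = P (g k @^-1` J) * P B.
Proof.
move=> mJ; apply: independence_dynkin.
- by rewrite -[X in measurable X]setTI; exact: measurable_funP.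
- exact: other_cylinders_setI.
- by move=> C; exact: other_cylinders_independence.
Qed.

Lemma measurable_other_weights x : measurable_fun setT (other_weights x).
Proof.
move=> _ A mA; rewrite setTI.
have [] := @sigma_indep setT (other_weights x @^-1` A) measurableT; last by [].
by rewrite -[X in _ X]setTI; exact: other_weights_measurable_sigma.
Qed.

Lemma anticoncentration_weight x (h e : R) : (0 < h)%R -> (0 <= e)%R ->
  (forall u, P (g k @^-1` `[u, (u + 3 * h)%R]%classic) <= e%:E) ->
  P [set w | `|g k w - other_weights x w| <= h]%R <= e%:E.
Proof.
move=> h0 e0 He; apply: anticoncentration_independent => //.
  exact: measurable_other_weights.
move=> I J mI mJ.
have [] := @sigma_indep J (other_weights x @^-1` I) mJ; last by [].
by rewrite -[X in _ X]setTI; exact: other_weights_measurable_sigma.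
Qed.

End weights_independence.

(** * Small intervals and tails of the Gamma distribution *)
Section gamma_bounds.
Context {R : realType}.
Variable a : R.
Hypothesis a_gt0 : 0 < a.
Local Notation mu := (@lebesgue_measure R).

(** One constant for all the exponents up to a + 1: the exponent a bounds the
    density t^(a-1) e^-t by C / t, and a + 1 bounds it by C / t^2. *)
Lemma expR_ge_powR : exists2 C : R, 0 < C & forall b x, 0 <= b <= a + 1 -> 0 < x ->
  x `^ b <= C * expR x.
Proof.
pose N := (Num.truncn (a + 1)).+1.
have aN : a + 1 <= N%:R by rewrite ltW// truncnS_gt.
exists (1 + N`!%:R) => [|b x /andP[b0 ba] x0].
  by rewrite addr_gt0// ltr0n fact_gt0.
have e1 : 1 <= expR x by rewrite -expR0 ler_expR ltW.
have f0 : 0 < N`!%:R :> R by rewrite ltr0n fact_gt0.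
have xN : x ^+ N <= N`!%:R * expR x.
  rewrite mulrC -ler_pdivrMr//; apply: le_trans (expR_ge1Dxn N.-1 (ltW x0)).
  by rewrite /= lerDr.
have [x1|x1] := leP 1 x.
  have : x `^ b <= x ^+ N.
    by rewrite -powR_mulrn ?(ltW x0)// ler_powR// (le_trans ba).
  lra.
have : x `^ b <= 1.
  have <- : 1 `^ b = 1 :> R by rewrite powR1.
  by rewrite ge0_ler_powR// ?nnegrE ltW.
nra.
Qed.

Lemma measurable_gamma_pdf : measurable_fun setT (gamma_pdf a).
Proof.
rewrite /gamma_pdf; apply/measurable_restrict => //; apply: measurable_funTS.
apply: measurable_funM; last exact: (measurableT_comp (@measurable_expR R)).
by apply: measurable_funM => //; exact: measurable_powR.
Qed.

Lemma Gamma_ge0 : 0 <= Gamma a.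
Proof.
by apply: Rintegral_ge0 => t _; rewrite mulr_ge0 ?powR_ge0 ?expR_ge0.
Qed.

Lemma gamma_pdf_ge0 t : 0 <= gamma_pdf a t.
Proof.
apply: restrict_ge0 => {}t _.
by rewrite !mulr_ge0 ?powR_ge0 ?expR_ge0 ?invr_ge0 ?Gamma_ge0.
Qed.

Lemma gamma_prob_itv_le (u v M : R) : u < v -> 0 <= M ->
  (forall x, 0 < x -> u < x <= v -> x `^ (a - 1) * expR (- x) <= M) ->
  (gamma_prob a `]u, v]%classic <= ((Gamma a)^-1 * M * (v - u))%:E)%E.
Proof.
move=> uv M0 H.
have c0 : 0 <= (Gamma a)^-1 by rewrite invr_ge0 Gamma_ge0.
apply: (@le_trans _ _ (\int[mu]_(x in `]u, v]) (cst ((Gamma a)^-1 * M)%:E x))%E).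
  apply: ge0_le_integral => //.
  - by move=> x _; rewrite lee_fin gamma_pdf_ge0.
  - by apply/measurable_funTS/measurableT_comp => //; exact: measurable_gamma_pdf.
  - move=> x /=; rewrite in_itv /= => uxv; rewrite lee_fin /gamma_pdf patchE.
    case: ifPn => [|_]; last by rewrite mulr_ge0.
    by rewrite inE /= in_itv /= andbT => x0; rewrite -mulrA ler_wpM2l// H.
rewrite integral_cst//= lebesgue_measure_itv /= lte_fin uv.
by rewrite -EFinB -EFinM.
Qed.

Lemma gamma_prob_neg : gamma_prob a `]-oo, 0]%classic = 0%E.
Proof.
rewrite /gamma_prob integral0_eq// => x /=; rewrite in_itv /= => x0.
rewrite /gamma_pdf patchE; case: ifPn => //.
by rewrite inE /= in_itv /= andbT ltNge x0.
Qed.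

End gamma_bounds.

Section gamma_law.
Context d (T : measurableType d) (R : realType) (P : probability T R).
Variable a : R.
Hypothesis a_gt0 : 0 < a.

Definition gamma_law (X : {RV P >-> R}) :=
  forall A, measurable A -> distribution P X A = gamma_prob a A.

(** Dyadic decompositions of (0, s] and of (t, +oo) are estimated block by block. *)
Lemma probability_geometric_cover (A : set T) (F : nat -> set T) (K q : R) :
  measurable A -> (forall j, measurable (F j)) -> A `<=` \bigcup_j F j ->
  0 <= K -> 0 < q < 1 -> (forall j, (P (F j) <= (K * q ^+ j)%:E)%E) ->
  (P A <= (K / (1 - q))%:E)%E.
Proof.
move=> mA mF AF K0 /andP[q0 q1] H.
apply: le_trans (measure_sigma_subadditive _ mF mA AF) _.
apply: lime_le; first by apply: is_cvg_nneseries => *; exact: measure_ge0.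
apply: nearW => m.
apply: (@le_trans _ _ (\sum_(0 <= j < m) (K * q ^+ j)%:E)%E); first by apply: lee_sum => j _; exact: H.
rewrite sumEFin lee_fin.
have -> : \sum_(0 <= j < m) (K * q ^+ j) = series (geometric K q) m by [].
rewrite geometric_seriesE ?lt_eqF// ler_wpM2r ?invr_ge0 ?subr_ge0 ?(ltW q1)//.
by rewrite ler_piMr// gerBl exprn_ge0// (ltW q0).
Qed.

Lemma gamma_law_pos X : gamma_law X -> P (X @^-1` `]-oo, 0%R]%classic) = 0%E.
Proof. by move=> gX; have := gX _ (measurable_itv `]-oo, 0%R]); rewrite gamma_prob_neg. Qed.

Let mX (X : {RV P >-> R}) (A : set R) : measurable A -> measurable (X @^-1` A).
Proof. by move=> mA; rewrite -[X in measurable X]setTI; exact: measurable_funP. Qed.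

Lemma gamma_law_itv X (u v M : R) : gamma_law X -> u < v -> 0 <= M ->
  (forall x, 0 < x -> u < x <= v -> x `^ (a - 1) * expR (- x) <= M) ->
  (P (X @^-1` `]u, v]%classic) <= ((Gamma a)^-1 * M * (v - u))%:E)%E.
Proof.
move=> gX uv M0 H; have /= := gX _ (measurable_itv `]u, v]).
by rewrite /distribution /pushforward => ->; exact: gamma_prob_itv_le.
Qed.

Lemma dyadic (x : R) : 1 < x -> exists j : nat, 2 ^+ j < x <= 2 ^+ j.+1.
Proof.
move=> x1; have H : exists m, x <= 2 ^+ m.
  exists (Num.truncn x).+1; rewrite (le_trans (ltW (truncnS_gt x)))//.
  by rewrite -natrX ler_nat ltnW// ltn_expl.
case: (ex_minnP H) => -[|j] xj minj.
  by move: xj; rewrite expr0 leNgt x1.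
exists j; rewrite xj andbT ltNge; apply/negP => /minj; by rewrite ltnn.
Qed.

(** On (v, 2v] the density is O(1 / v^2), so the block has mass O(1 / v); sum over
    v = t 2^j. *)
Lemma gamma_law_tail : exists2 K : R, 0 <= K & forall X t, gamma_law X -> 0 < t ->
  (P (X @^-1` `]t, +oo[%classic) <= (K / t)%:E)%E.
Proof.
have [C C0 HC] := expR_ge_powR a.
have c0 : 0 <= (Gamma a)^-1 by rewrite invr_ge0 Gamma_ge0.
exists ((Gamma a)^-1 * C * 2) => [|X t gX t0]; first by rewrite !mulr_ge0// ltW.
have -> : (Gamma a)^-1 * C * 2 / t = ((Gamma a)^-1 * C / t) / (1 - 2^-1).
  have -> : 1 - 2^-1 = 2^-1 :> R by lra.
  by rewrite invrK; ring.
pose F j := X @^-1` `]t * 2 ^+ j, t * 2 ^+ j.+1]%classic.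
apply: (@probability_geometric_cover _ F).
- exact/mX.
- by move=> j; exact/mX.
- move=> w /=; rewrite in_itv /= andbT => tX.
  have [j Hj] : exists j : nat, 2 ^+ j < X w / t <= 2 ^+ j.+1.
    by apply: dyadic; rewrite ltr_pdivlMr// mul1r.
  exists j => //; rewrite /F /= in_itv /=.
  by rewrite mulrC -ltr_pdivlMr// [t * _]mulrC -ler_pdivrMr.
- by rewrite !mulr_ge0// ?invr_ge0 ltW.
- by apply/andP; split; lra.
- move=> j; set v := t * 2 ^+ j.
  have v0 : 0 < v by rewrite mulr_gt0 ?exprn_gt0.
  have v2 : t * 2 ^+ j.+1 = 2 * v by rewrite exprS /v; ring.
  have -> : F j = X @^-1` `]v, 2 * v]%classic by rewrite /F v2.
  apply: le_trans (@gamma_law_itv X v (2 * v) (C / v ^+ 2) gX _ _ _) _.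
  + lra.
  + by rewrite divr_ge0 ?exprn_ge0// ltW.
  + move=> x x0 /andP[vx _]; rewrite expRN ler_pdivrMr ?expR_gt0//.
    rewrite mulrAC ler_pdivlMr ?exprn_gt0//.
    apply: le_trans (HC (a + 1) x _ x0); last by rewrite lexx addr_ge0 ?ltW.
    have -> : x `^ (a + 1) = x `^ (a - 1) * x ^+ 2.
      by rewrite -powR_mulrn ?ltW// -powRD ?(gt_eqF x0) ?implybT//; congr (_ `^ _); ring.
    by rewrite ler_wpM2l ?powR_ge0// lerXn2r ?nnegrE ?(ltW x0) ?(ltW v0) ?(ltW vx).
  + have p0 : 0 < 2 ^+ j :> R by rewrite exprn_gt0.
    rewrite lee_fin /v exprVn le_eqVlt; apply/orP; left; apply/eqP.
    move: (Gamma a)^-1 => c; move: (2 ^+ j) p0 => p p0.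
    by field; rewrite !gt_eqF.
Qed.

(** The density may blow up at 0, so the interval is cut at s.  Below s, the block
    (v, 2v] has mass O(v^a), and summing over v = s / 2^(j+1) gives O(s^a); above
    s the density is O(1 / s). *)
Lemma gamma_law_interval : exists2 K : R, 0 <= K &
  forall X s h u, gamma_law X -> 0 < s -> 0 < h ->
  (P (X @^-1` `[u, (u + h)%R]%classic) <= (K * (s `^ a + h / s))%:E)%E.
Proof.
have [C C0 HC] := expR_ge_powR a.
have c0 : 0 <= (Gamma a)^-1 by rewrite invr_ge0 Gamma_ge0.
pose q : R := 2^-1 `^ a.
have q0 : 0 < q by rewrite powR_gt0// invr_gt0.
have q1 : q < 1.
  have E : 1 `^ a = 1 :> R by rewrite powR1.
  rewrite /q -[ltRHS]E gt0_ltr_powR// ?nnegrE ?invr_ge0//.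
  by lra.
pose K := (Gamma a)^-1 * ((1 - q)^-1 + 2 * C).
have K0 : 0 <= K.
  by rewrite mulr_ge0// addr_ge0 ?invr_ge0 ?subr_ge0 ?mulr_ge0 ?ltW.
exists K => // X s h u gX s0 h0.
have low : (P (X @^-1` `]0%R, s]%classic) <= (((Gamma a)^-1 * s `^ a) / (1 - q))%:E)%E.
  pose F j := X @^-1` `]s / 2 ^+ j.+1, s / 2 ^+ j]%classic.
  apply: (@probability_geometric_cover _ F).
  - exact/mX.
  - by move=> j; exact/mX.
  - move=> w /=; rewrite in_itv /= => /andP[X0 Xs].
    have [j Hj] : exists j : nat, 2 ^+ j <= s / X w < 2 ^+ j.+1.
      have [m Hm] : exists m, s / X w < 2 ^+ m.
        exists (Num.truncn (s / X w)).+1; rewrite (lt_le_trans (truncnS_gt _))//.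
        by rewrite -natrX ler_nat ltnW// ltn_expl.
      have H : exists m, s / X w < 2 ^+ m by exists m.
      case: (ex_minnP H) => -[|j] xj minj.
        by move: xj; rewrite expr0 ltr_pdivrMr// mul1r ltNge Xs.
      exists j; rewrite xj andbT leNgt; apply/negP => /minj; by rewrite ltnn.
    exists j => //; rewrite /F /= in_itv /=; move: Hj => /andP[H1 H2].
    rewrite ltr_pdivrMr ?exprn_gt0// mulrC -ltr_pdivrMr// H2 /=.
    by rewrite ler_pdivlMr ?exprn_gt0// mulrC -ler_pdivlMr.
  - by rewrite mulr_ge0 ?powR_ge0.
  - by rewrite q0.
  - move=> j; set v := s / 2 ^+ j.+1.
    have v0 : 0 < v by rewrite divr_gt0 ?exprn_gt0.
    have v2 : s / 2 ^+ j = 2 * v.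
      by rewrite /v exprS; field; rewrite gt_eqF ?exprn_gt0.
    have -> : F j = X @^-1` `]v, 2 * v]%classic by rewrite /F v2.
    apply: le_trans (@gamma_law_itv X v (2 * v) ((2 * v) `^ a / v) gX _ _ _) _.
    + lra.
    + by rewrite divr_ge0 ?powR_ge0// ltW.
    + move=> x x0 /andP[vx xv].
      have ex : expR (- x) <= 1 by rewrite -expR0 ler_expR oppr_le0 ltW.
      have ge0 := powR_ge0 x (a - 1).
      apply: (@le_trans _ _ (x `^ (a - 1))); first by rewrite ler_piMr.
      rewrite ler_pdivlMr//; apply: (@le_trans _ _ (x `^ (a - 1) * x)).
        by rewrite ler_wpM2l ?powR_ge0// ltW.
      rewrite mulrC mulr_powRB1 ?(ltW x0)// ge0_ler_powR ?nnegrE ?(ltW x0) ?(ltW a_gt0)//.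
      by rewrite mulr_ge0 ?(ltW v0).
    + rewrite lee_fin -v2 powRM ?invr_ge0 ?exprn_ge0 ?(ltW s0)//.
      have -> : (2 ^+ j)^-1 `^ a = q ^+ j.
        rewrite -exprVn -[in LHS]powR_mulrn ?invr_ge0//.
        by rewrite -powRrM mulrC powRrM -/q powR_mulrn// ltW.
      rewrite v2 le_eqVlt; apply/orP; left; apply/eqP.
      by move: (Gamma a)^-1 => c; field; rewrite gt_eqF.
(* The half-open interval (m, m + 2h] starts at u - h so as to contain u. *)
pose m := Num.max s (u - h).
have hs : (P (X @^-1` `]m, (m + 2 * h)%R]%classic) <= ((Gamma a)^-1 * (C / s) * (2 * h))%:E)%E.
  have := @gamma_law_itv X m (m + 2 * h) (C / s) gX.
  rewrite addrAC subrr add0r; apply.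
  - by rewrite ltrDl mulr_gt0.
  - by rewrite divr_ge0// ltW.
  - move=> x x0 /andP[mx _].
    have sx : s <= x by apply: le_trans (ltW mx); rewrite le_max lexx.
    rewrite expRN ler_pdivrMr ?expR_gt0// mulrAC ler_pdivlMr//.
    apply: le_trans (HC a x _ x0); last by rewrite ltW//= lerDl.
    rewrite -(mulr_powRB1 (ltW x0) a_gt0) mulrC.
    by rewrite ler_wpM2r ?powR_ge0.
apply: (@le_trans _ _ (P (X @^-1` `]-oo, 0%R] `|` (X @^-1` `]0%R, s] `|` X @^-1` `]m, (m + 2 * h)%R])))).
  apply: le_measure; rewrite ?inE.
  - exact/mX.
  - apply: measurableU; [exact/mX|apply: measurableU; exact/mX].
  - move=> w /=; rewrite !in_itv /= => /andP[uX Xu].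
    have [|X0] := leP (X w) 0; first by left.
    right; have [|Xs] := leP (X w) s; first by left.
    right; rewrite gt_max Xs /=; apply/andP; split; first lra.
    have : u - h <= m by rewrite le_max lexx orbT.
    lra.
have m0 : measurable (X @^-1` `]-oo, 0%R]) by exact/mX.
have m1 : measurable (X @^-1` `]0%R, s]) by exact/mX.
have m2 : measurable (X @^-1` `]m, (m + 2 * h)%R]) by exact/mX.
apply: le_trans (measureU2 P m0 (measurableU _ _ m1 m2)) _.
have z0 : (P (X @^-1` `]-oo, 0%R]%classic) <= 0)%E by rewrite gamma_law_pos.
apply: le_trans (leeD z0 (measureU2 P m1 m2)) _; rewrite add0e.
apply: le_trans (leeD low hs) _; rewrite -EFinD lee_fin /K.
have A0 : 0 <= s `^ a by exact: powR_ge0.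
have B0 : 0 <= h / s by rewrite divr_ge0// ltW.
have D0 : 0 <= (1 - q)^-1 by rewrite invr_ge0 subr_ge0 ltW.
have -> : (Gamma a)^-1 * s `^ a / (1 - q) + (Gamma a)^-1 * (C / s) * (2 * h) =
  (Gamma a)^-1 * (s `^ a * (1 - q)^-1 + 2 * C * (h / s)) by ring.
rewrite -[leRHS]mulrA ler_wpM2l//.
have := mulr_ge0 D0 B0; have := mulr_ge0 (ltW C0) A0; nra.
Qed.

End gamma_law.

(** * Borel-Cantelli *)
Section borel_cantelli.
Context d (T : measurableType d) (R : realType) (P : probability T R).

Lemma ae_eventually_not (F : nat -> set T) (C : R) :
  (forall n, measurable (F n)) -> 0 <= C ->
  (forall n, (0 < n)%N -> (P (F n) <= (C / n%:R ^+ 2)%:E)%E) ->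
  {ae P, forall w, exists N, forall n, (N <= n)%N -> ~ F n w}.
Proof.
move=> mF C0 HF.
(* 1 / n^2 <= 1 / (n - 1) - 1 / n telescopes. *)
have partial m : (\sum_(0 <= n < m.+2) P (F n) <= (1 + C * (2 - m.+1%:R^-1))%:E)%E.
  elim: m => [|m IH].
    rewrite big_nat_recr//= big_nat1 invr1 EFinD; apply: leeD.
      exact: probability_le1.
    by apply: le_trans (HF 1%N _) _ => //; rewrite lee_fin expr1n; lra.
  rewrite big_nat_recr//=; apply: le_trans (leeD IH (HF m.+2 _)) _ => //.
  rewrite -EFinD lee_fin -addrA lerD2l -mulrDr ler_wpM2l//.
  have a0 : 0 < m.+1%:R :> R by rewrite ltr0n.
  have b0 : 0 < m.+2%:R :> R by rewrite ltr0n.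
  rewrite -addrA lerD2l -lerBrDl opprK addrC.
  have -> : m.+1%:R^-1 - m.+2%:R^-1 = (m.+1%:R * m.+2%:R)^-1 :> R.
    by rewrite -[m.+2]addn1 natrD in b0 *; field; rewrite !gt_eqF.
  rewrite lef_pV2 ?posrE ?exprn_gt0 ?mulr_gt0// expr2 ler_wpM2r ?(ltW b0)//.
  by rewrite ler_nat.
have fin : (\sum_(n <oo) P (F n) < +oo)%E.
  apply: (@le_lt_trans _ _ (1 + C * 2)%:E); last exact: ltry.
  apply: lime_le; first by apply: is_cvg_nneseries => *; exact: measure_ge0.
  exists 2%N => // -[|[|m]] //= _; apply: le_trans (partial m) _.
  by rewrite lee_fin lerD2l ler_wpM2l// gerBl invr_ge0.
have null := lim_sup_set_cvg0 mF fin.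
exists (lim_sup_set F); split => //.
  apply: bigcapT_measurable => n; apply: bigcup_measurable => k _; exact: mF.
move=> w /= H n _; apply: contrapT => Hn; apply: H; exists n => k nk Fk.
by apply: Hn; exists k.
Qed.

Lemma ae_forall_countable (I : countType) (Q : I -> T -> Prop) :
  (forall i, {ae P, forall w, Q i w}) -> {ae P, forall w, forall i, Q i w}.
Proof.
move=> H.
pose F k := if @unpickle I k is Some i then ~` [set w | Q i w] else set0.
change (P.-negligible (~` [set w | forall i, Q i w])).
apply: (@negligibleS _ _ _ P (\bigcup_k F k)); last first.
  apply: negligible_bigcup => k; rewrite /F; case: unpickle => [i|]; first exact: H.
  exact: negligible_set0.
move=> w /= /existsNP[i nQ]; exists (pickle i) => //.
by rewrite /F pickleK.
Qed.

End borel_cantelli.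

(** * Almost sure lower bounds on the meshes *)
Section almost_sure_comparison.
Context d (T : measurableType d) (R : realType) (P : probability T R).
Variable a : R.
Hypothesis a_gt0 : 0 < a.
Unset Implicit Arguments.
Variables (Z : forall n : nat, 'I_n -> {RV P >-> R[i]})
          (g : forall n : nat, 'I_n -> {RV P >-> R}).
Set Implicit Arguments.
Hypothesis g_indep : forall n : nat, (0 < n)%N -> mutually_independent (g n).
Hypothesis g_gamma : forall n (k : 'I_n), gamma_law a (g n k).
Hypothesis gZ_indep : forall n : nat, (0 < n)%N -> independent_families (g n) (Z n).

Let mg n (k : 'I_n) (A : set R) : measurable A -> measurable (g n k @^-1` A).
Proof. by move=> mA; rewrite -[X in measurable X]setTI; exact: measurable_funP. Qed.

Lemma weights_gt0 : {ae P, forall w, forall n (k : 'I_n), 0 < g n k w}.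
Proof.
have H (i : {n & 'I_n}) : {ae P, forall w, 0 < g (tag i) (tagged i) w}.
  exists (g (tag i) (tagged i) @^-1` `]-oo, 0%R]%classic); split; first exact: mg.
    exact: gamma_law_pos.
  by move=> w /= /negP; rewrite -leNgt in_itv.
apply: filterS (ae_forall_countable H) => w Hw n k.
exact: (Hw (Tagged (fun n => 'I_n) k)).
Qed.

Lemma probability_bigsetU_le (I : eqType) (s : seq I) (F : I -> set T) (e : R) :
  (forall i, measurable (F i)) -> (forall i, i \in s -> (P (F i) <= e%:E)%E) ->
  (P (\big[setU/set0]_(i <- s) F i) <= ((size s)%:R * e)%:E)%E.
Proof.
move=> mF; elim: s => [|i s IH] H; first by rewrite big_nil measure0 mul0r.
rewrite big_cons; apply: le_trans (measureU2 P (mF i) _) _.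
  by apply: bigsetU_measurable => j _; exact: mF.
rewrite [size _]/= mulrSr mulrDl mul1r addrC EFinD; apply: leeD.
  by apply: IH => j js; apply: H; rewrite inE js orbT.
by apply: H; rewrite mem_head.
Qed.

Lemma weights_le : {ae P, forall w, exists N, forall n, (N <= n)%N ->
  forall k : 'I_n, g n k w <= n%:R ^+ 3}.
Proof.
have [K K0 HK] := gamma_law_tail P a_gt0.
pose F n := \big[setU/set0]_(k <- enum 'I_n) (g n k @^-1` `]n%:R ^+ 3, +oo[%classic).
have mF n : measurable (F n) by apply: bigsetU_measurable => k _; exact: mg.
have H : {ae P, forall w, exists N, forall n, (N <= n)%N -> ~ F n w}.
  apply: (ae_eventually_not mF K0) => n n0.
  have n1 : 0 < n%:R :> R by rewrite ltr0n.
  have e0 : 0 < n%:R ^+ 3 :> R by rewrite exprn_gt0.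
  apply: le_trans (@probability_bigsetU_le _ _ _ (K / n%:R ^+ 3) _ _) _.
  - by move=> k; exact: mg.
  - by move=> k _; exact: HK.
  - by rewrite size_enum_ord lee_fin le_eqVlt; apply/orP; left; apply/eqP; field; rewrite gt_eqF.
apply: filterS H => w [N HN]; exists N => n nN k.
rewrite leNgt; apply/negP => lt; apply: (HN n nN).
rewrite /F -bigcup_seq; exists k; first by rewrite /= mem_enum.
by rewrite /= in_itv /= lt.
Qed.

(** All the indices k are included in the union, so that a random k can be used
    later without conditioning on it.  For each of the 2n^3 triples, an interval of
    length of order n^-(m+5) is cut at s = n^-m, which gives the probability
    O(s^a + h / s) = O(n^-5) as soon as m a >= 5. *)
Lemma anticoncentration_mesh : exists p : nat, forall (c : R[i]) (r : R),
  {ae P, forall w, exists N, forall n, (N <= n)%N ->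
    forall (k : 'I_n) j x, (j < n.*2)%N -> x \in mesh n r j ->
    n%:R ^- p < `|g n k w - other_weights (g n) (Z n) k (c + x) w|}.
Proof.
have [K K0 HK] := gamma_law_interval P a_gt0.
pose m := (Num.truncn (5 / a)).+1.
have ma : 5 <= m%:R * a by rewrite -ler_pdivrMr// ltW// truncnS_gt.
exists (m + 5)%N => c r.
pose A n (i : 'I_n * R[i]) := [set w |
  `|g n i.1 w - other_weights (g n) (Z n) i.1 (c + i.2) w| <= n%:R ^- (m + 5)].
pose M n := flatten [seq mesh n r j | j <- iota 0 n.*2].
have sM n : (0 < n)%N -> size (M n) = (n.*2 * n)%N.
  move=> n0; rewrite size_flatten /shape -map_comp.
  rewrite (eq_map (g := fun=> n)); last by move=> j; exact: size_mesh.
  by rewrite -[X in (X * n)%N](size_iota 0); elim: iota => //= j l ->; rewrite mulSn.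
pose F n := if (0 < n)%N then \big[setU/set0]_(i <- [seq (k, x) | k <- enum 'I_n, x <- M n]) A n i else set0.
have mA n i : (0 < n)%N -> measurable (A n i).
  move=> n0.
  have -> : A n i = (fun w => `|g n i.1 w - other_weights (g n) (Z n) i.1 (c + i.2) w|) @^-1` `]-oo, (n%:R ^- (m + 5))].
    by apply/seteqP; split => w /=; rewrite in_itv.
  rewrite -[X in measurable X]setTI; apply: measurableT_comp => //.
  apply: measurable_funB => //.
  by apply: measurable_other_weights; [exact: g_indep|exact: gZ_indep].
have mF n : measurable (F n).
  rewrite /F; case: ifPn => // n0; apply: bigsetU_measurable => i _; exact: mA.
have H : {ae P, forall w, exists N, forall n, (N <= n)%N -> ~ F n w}.
  apply: (@ae_eventually_not _ _ _ P F (8 * K)) => //; first by rewrite mulr_ge0.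
  move=> n n0; rewrite /F n0.
  have n1 : 0 < n%:R :> R by rewrite ltr0n.
  have n1' : 1 <= n%:R :> R by rewrite ler1n.
  apply: le_trans (@probability_bigsetU_le _ _ _ (4 * K / n%:R ^+ 5) _ _) _.
  - by move=> i; exact: mA.
  - move=> i _; apply: anticoncentration_weight => //.
    + exact: g_indep.
    + exact: gZ_indep.
    + by rewrite invr_gt0 exprn_gt0.
    + by rewrite divr_ge0 ?mulr_ge0 ?exprn_ge0// ltW.
    + move=> u; have s0 : 0 < n%:R ^- m :> R by rewrite invr_gt0 exprn_gt0.
      have h0 : 0 < 3 * n%:R ^- (m + 5) :> R by rewrite mulr_gt0 ?invr_gt0 ?exprn_gt0.
      apply: le_trans (HK _ _ _ u (g_gamma i.1) s0 h0) _.
      rewrite lee_fin.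
      have s1 : (n%:R ^- m) `^ a <= n%:R ^- 5 :> R.
        have -> : n%:R ^- m = n%:R `^ (- m%:R) :> R by rewrite powR_invn// ltW.
        rewrite -powRrM -[leRHS]powR_invn ?(ltW n1)//.
        by rewrite ler_powR// mulNr lerN2.
      have -> : 3 * n%:R ^- (m + 5) / n%:R ^- m = 3 * n%:R ^- 5 :> R.
        have q0 : n%:R ^+ m != 0 :> R by rewrite expf_neq0// gt_eqF.
        rewrite exprD; move: (n%:R ^+ m) q0 => q q0.
        by field; rewrite q0 gt_eqF.
      by rewrite [4 * K]mulrC -mulrA ler_wpM2l//; lra.
  - rewrite size_allpairs size_enum_ord sM// lee_fin !natrM -muln2 natrM.
    by rewrite le_eqVlt; apply/orP; left; apply/eqP; field; rewrite gt_eqF.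
apply: filterS H => w [N HN]; exists N => n nN k j x jn xm.
have n0 : (0 < n)%N by exact: leq_ltn_trans (ltn_ord k).
rewrite ltNge; apply/negP => le; apply: (HN n nN).
rewrite /F n0 -bigcup_seq; exists (k, x) => //=.
apply: allpairs_f; first by rewrite mem_enum.
apply/flattenP; exists (mesh n r j) => //.
by apply: map_f; rewrite mem_iota.
Qed.

End almost_sure_comparison.

(** * Logarithmic sums over points and zeros *)
Section comparison.
Context {R : realType}.

Lemma log_eventually_le (A B e : R) : 0 < e ->
  exists N, forall n, (N <= n)%N -> A + B * ln n%:R <= e * n%:R.
Proof.
move=> e0; pose K := `|A| + 2 * `|B|.
have K0 : 0 <= K by rewrite addr_ge0// mulr_ge0.
exists (Num.truncn ((K / e) ^+ 2)).+1 => n Nn.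
have nK : (K / e) ^+ 2 <= n%:R.
  by rewrite (le_trans (ltW (truncnS_gt _)))// ler_nat.
have n1 : 1 <= n%:R :> R by rewrite ler1n (leq_trans _ Nn).
pose s := Num.sqrt n%:R : R.
have s1 : 1 <= s by rewrite -sqrtr1 ler_wsqrtr.
have s0 : 0 < s by exact: lt_le_trans s1.
have ss : s ^+ 2 = n%:R by rewrite sqr_sqrtr.
have Ks : K <= e * s.
  rewrite mulrC -ler_pdivrMr//.
  by rewrite -(ler_pXn2r (ltn0Sn 1)) ?nnegrE ?divr_ge0 ?(ltW e0) ?(ltW s0)// ss.
have lns : 0 <= ln (n%:R : R) <= 2 * s.
  have -> : ln (n%:R : R) = 2 * ln s by rewrite -ss lnXn// mulr_natl.
  by rewrite mulr_ge0 ?ln_ge0//= ler_wpM2l// ltW// ln_sublinear.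
have : A + B * ln n%:R <= K * s.
  rewrite /K mulrDl; apply: lerD.
    by rewrite (le_trans (ler_norm A))// ler_peMr.
  rewrite (le_trans (ler_norm _))// normrM mulrAC mulrC ler_wpM2r//.
  by case/andP: lns => l0 l1; rewrite ger0_norm.
move=> /le_trans; apply; rewrite -ss expr2 mulrA ler_wpM2r// ltW//.
Qed.

(** The modulus of (x - z_k) Q(x) / P(x) is at least that of its real part; if
    P(x) = 0 there is nothing to prove. *)
Lemma randomized_derivative_ge n (g : 'I_n -> R) (z : 'I_n -> R[i]) k x h :
  0 <= h ->
  h < `|g k - - complex.Re ((x - z k) *
         \sum_(j < n | j != k) real_complex R (g j) / (x - z j))| ->
  h * \prod_j normc (x - z j) <=
    normc (x - z k) * normc (randomized_derivative g z).[x].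
Proof.
move=> h0 hk; rewrite -normc_prod.
have [p0|p0] := eqVneq (\prod_j (x - z j)) 0.
  by rewrite p0 normc0 mulr0 mulr_ge0 ?normc_ge0.
have xz j : x - z j != 0 by move/prodf_neq0: p0; apply.
rewrite -normcM.
have -> : (x - z k) * (randomized_derivative g z).[x] =
  \prod_j (x - z j) * (real_complex R (g k) + (x - z k) *
         \sum_(j < n | j != k) real_complex R (g j) / (x - z j)).
  have E j : real_complex R (g j) * \prod_(i < n | i != j) (x - z i) =
     \prod_i (x - z i) * (real_complex R (g j) / (x - z j)).
    by rewrite [in RHS](bigD1 j)//=; field; exact: xz.
  rewrite horner_randomized_derivative (eq_bigr _ (fun j _ => E j)) -mulr_sumr.
  rewrite mulrCA; congr (_ * _); rewrite (bigD1 k)//= mulrDr; congr (_ + _).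
  by rewrite mulrC divfK.
rewrite normcM mulrC ler_wpM2l ?normc_ge0//.
apply: le_trans (ltW hk) _; apply: le_trans (ler_Re_normc _).
by rewrite opprK raddfD.
Qed.

Lemma mesh_bound n (r : R) j x : (0 < n)%N -> 0 < r -> (j < n.*2)%N ->
  x \in mesh n r j -> normc x <= 2 * r.
Proof.
move=> n0 r0 jn xm.
rewrite -(ler_pXn2r n0) ?nnegrE ?normc_ge0 ?mulr_ge0 ?(ltW r0)//.
rewrite -normcX (meshX n0 xm) normc_real ger0_norm; last first.
  by rewrite (le_trans _ (level_ge n j (ltW r0)))// exprn_ge0// ltW.
rewrite (le_trans (level_le (ltW r0) jn))// exprMn ler_wpM2r ?exprn_ge0// ?(ltW r0)//.
by rewrite ler_eXnr// ler1n.
Qed.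

(** The lower bound on |Q(x)| loses the factor |x - z_k|, so it needs one k for
    which this is bounded. *)
Definition some_point_bounded (z : forall n, 'I_n -> R[i]) :=
  exists M : R, exists N, forall n, (N <= n)%N -> exists k : 'I_n, normc (z n k) <= M.

(** All the quantities in the bound of [sum_logmax_zeros] are controlled by powers
    of n, and only their logarithms count. *)
Lemma sum_logmax_sublinear (g : forall n, 'I_n -> R) (z : forall n, 'I_n -> R[i])
    (p : nat) (c : R[i]) (r : R) : 0 < r ->
  (forall n (k : 'I_n), 0 < g n k) ->
  (exists N, forall n, (N <= n)%N -> forall k : 'I_n, g n k <= n%:R ^+ 3) ->
  some_point_bounded z ->
  (exists N, forall n, (N <= n)%N ->
    forall (k : 'I_n) j x, (j < n.*2)%N -> x \in mesh n r j ->
    n%:R ^- p < `|g n k - - complex.Re ((c + x - z n k) *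
       \sum_(j < n | j != k) real_complex R (g n j) / (c + x - z n j))|) ->
  forall e, 0 < e -> exists N, forall n, (N <= n)%N ->
  `|\sum_(w <- zeros (randomized_derivative (g n) (z n))) logmax r (w - c) -
    \sum_k logmax r (z n k - c)| <= e * n%:R.
Proof.
move=> r0 g0 [N1 H1] [M0 [N2 H2]] [N3 H3] e e0.
pose M := Num.max M0 0.
have M_ge0 : 0 <= M by rewrite le_max lexx orbT.
pose D := normc c + 2 * r + M.
have D0 : 0 < D by have := normc_ge0 c; rewrite /D; lra.
pose A := `|ln D| + `|ln (32 / r)| + 2 * ln 16.
have [N4 H4] := log_eventually_le A (p + 6)%:R e0.
exists (maxn (maxn N1 N2) (maxn N3 (maxn N4 1))) => n.
rewrite !geq_max => /andP[/andP[n1 n2] /and3P[n3 n4 n0]].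
have [k Mk] := H2 n n2.
have nr0 : 0 < n%:R :> R by rewrite ltr0n.
pose eta := n%:R ^- p / D : R.
have eta0 : 0 < eta by rewrite divr_gt0// invr_gt0 exprn_gt0.
have low j x : (j < n.*2)%N -> x \in mesh n r j ->
    eta * \prod_i normc (c + x - z n i) <= normc (randomized_derivative (g n) (z n)).[c + x].
  move=> jn xm; have h0 : 0 <= n%:R ^- p :> R by rewrite invr_ge0 exprn_ge0.
  have := randomized_derivative_ge h0 (H3 n n3 k j x jn xm).
  rewrite /eta mulrAC ler_pdivrMr// => /le_trans; apply.
  rewrite [leRHS]mulrC ler_wpM2r ?normc_ge0//.
  rewrite (le_trans (ler_normcD _ _))// normc_opp /D lerD//.
    by rewrite (le_trans (ler_normcD _ _))// lerD2l (mesh_bound n0 r0 jn).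
  by rewrite (le_trans Mk)// le_max lexx.
apply: le_trans (sum_logmax_zeros n0 (g0 n) r0 eta0 low) _.
apply: le_trans (H4 n n4).
have G0 := sum_weights_gt0 n0 (g0 n).
have ln0 : 0 <= ln n%:R :> R by rewrite ln_ge0// ler1n.
have l16 : ln (16 * n)%:R = ln 16 + ln n%:R :> R by rewrite natrM lnM ?posrE.
have lG : ln (\sum_i g n i) <= 4 * ln n%:R.
  rewrite mulr_natl -lnXn// ler_ln ?posrE ?exprn_gt0//.
  rewrite (le_trans (ler_sum _ (fun i _ => H1 n n1 i)))//.
  by rewrite sumr_const card_ord -[leLHS]mulr_natl -(exprS _ 3).
have leta : ln eta = - (p%:R * ln n%:R) - ln D.
  by rewrite ln_div ?posrE ?invr_gt0 ?exprn_gt0// lnV ?posrE ?exprn_gt0// lnXn// mulr_natl.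
have l32 : ln ((32 * n ^ 2)%:R / r) = ln (32 / r) + 2 * ln n%:R.
  rewrite natrM natrX mulrAC lnM ?posrE ?divr_gt0 ?exprn_gt0//.
  by congr (_ + _); rewrite lnXn// mulr_natl.
rewrite l16 leta l32 /A natrD.
have pl : 0 <= p%:R * ln n%:R :> R by rewrite mulr_ge0.
rewrite [(p%:R + _) * _]mulrDl; set G := ln (\sum_i g n i) in lG *.
have a1 := ler_norm (ln D); have a2 := ler_norm (ln (32 / r)).
have a3 := normr_ge0 (ln D); have a4 := normr_ge0 (ln (32 / r)).
move: (ln n%:R : R) (ln D) (ln (32 / r)) (ln 16 : R) (p%:R * ln n%:R) ln0 lG pl a1 a2 a3 a4.
move=> L x y v q ln0 lG pl a1 a2 a3 a4.
have [_|_] := leP (G - (- q - x)) (y + 2 * L); lra.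
Qed.

End comparison.

Section almost_sure.
Context d (T : measurableType d) (R : realType) (P : probability T R).
Variable a : R.
Hypothesis a_gt0 : 0 < a.
Unset Implicit Arguments.
Variables (Z : forall n : nat, 'I_n -> {RV P >-> R[i]})
          (g : forall n : nat, 'I_n -> {RV P >-> R}).
Set Implicit Arguments.
Hypothesis g_indep : forall n : nat, (0 < n)%N -> mutually_independent (g n).
Hypothesis g_gamma : forall n (k : 'I_n), gamma_law a (g n k).
Hypothesis gZ_indep : forall n : nat, (0 < n)%N -> independent_families (g n) (Z n).

Definition rat_complex (q : rat * rat) : R[i] := Complex (ratr q.1) (ratr q.2).

(** Rational parameters make the exceptional null sets countable in number. *)
Theorem ae_sum_logmax_sublinear : {ae P, forall w,
  (forall n (k : 'I_n), 0 < g n k w) /\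
  (some_point_bounded (fun n k => Z n k w) ->
  forall (q : rat * rat) (r : rat), 0 < r -> forall e, 0 < e ->
  exists N, forall n, (N <= n)%N ->
  `|\sum_(u <- zeros (randomized_derivative (fun k => g n k w) (fun k => Z n k w)))
       logmax (ratr r) (u - rat_complex q) -
    \sum_k logmax (ratr r) (Z n k w - rat_complex q)| <= e * n%:R)}.
Proof.
have [p Hp] := anticoncentration_mesh a_gt0 g_indep g_gamma gZ_indep.
have Hq := ae_forall_countable (fun i : (rat * rat) * rat => Hp (rat_complex i.1) (ratr i.2)).
have Hg := weights_gt0 g_gamma; have Hl := weights_le a_gt0 g_gamma.
near=> w; split; first by near: w.
move=> sb q r r0 e e0.
apply: (sum_logmax_sublinear (p := p) _ _ _ sb) => //.
- by rewrite ltr0q.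
- by near: w.
- by near: w.
- have : forall i : rat * rat * rat, exists N, forall n, (N <= n)%N ->
    forall (k : 'I_n) j x, (j < n.*2)%N -> x \in mesh n (ratr i.2 : R) j ->
    n%:R ^- p < `|g n k w - other_weights (g n) (Z n) k (rat_complex i.1 + x) w|.
    by near: w.
  by move=> /(_ (q, r)).
Unshelve. all: by end_near.
Qed.

End almost_sure.

(** * Annular bumps and their lattice sums *)
Section annular_bump.
Context {R : realType}.
Implicit Types (r : R) (u v : R[i]).

(** Unlike L_r, the difference L_2r - L_r has compact support: it is ln 2 on the
    disk of radius r and vanishes outside that of radius 2r. *)
Definition bump r v : R := logmax (2 * r) v - logmax r v.

Lemma logmax_lip r u v : 0 < r -> logmax r u - logmax r v <= normc (u - v) / r.
Proof.
move=> r0; rewrite /logmax.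
set x := Num.max (normc u) r; set y := Num.max (normc v) r.
have rx : r <= x by rewrite le_max lexx orbT.
have ry : r <= y by rewrite le_max lexx orbT.
have x0 : 0 < x by exact: lt_le_trans rx.
have y0 : 0 < y by exact: lt_le_trans ry.
have xy : x - y <= normc (u - v).
  have := ler_normcB u v; have := normc_ge0 (u - v).
  have : normc v <= y by rewrite le_max lexx.
  by rewrite /x; have [_|_] := leP (normc u) r; lra.
rewrite -ln_div ?posrE//.
have -> : x / y = 1 + (x - y) / y by rewrite mulrBl divff ?gt_eqF// addrC subrK.
apply: le_trans (le_ln1Dx _) _.
  by rewrite mulrBl divff ?gt_eqF//; have := divr_gt0 x0 y0; lra.
rewrite ler_pdivrMr// mulrAC ler_pdivlMr//.
apply: le_trans (ler_wpM2r (ltW r0) xy) _.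
by rewrite ler_wpM2l ?normc_ge0.
Qed.

Lemma bump_lip r u v : 0 < r -> `|bump r u - bump r v| <= 2 * normc (u - v) / r.
Proof.
move=> r0; have r2 : 0 < 2 * r by lra.
have a1 := logmax_lip u v r0; have a2 := logmax_lip v u r0.
have b1 := logmax_lip u v r2; have b2 := logmax_lip v u r2.
rewrite [normc (v - u)]normc_distC in a2 b2.
have : normc (u - v) / (2 * r) <= normc (u - v) / r.
  by rewrite ler_wpM2l ?normc_ge0// lef_pV2 ?posrE//; lra.
have -> : 2 * normc (u - v) / r = 2 * (normc (u - v) / r) by rewrite mulrA.
by rewrite /bump ler_norml => ?; apply/andP; split; lra.
Qed.

Lemma bump_out r v : 0 < r -> 2 * r <= normc v -> bump r v = 0.
Proof.
move=> r0 rv; rewrite /bump /logmax !(max_idPl _) ?subrr//; lra.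
Qed.

Lemma bump_in r v : 0 < r -> normc v <= r -> bump r v = ln 2.
Proof.
move=> r0 rv; rewrite /bump /logmax !(max_idPr _) //; last lra.
by rewrite lnM ?posrE// addrK.
Qed.

Lemma bump_itv r v : 0 < r -> 0 <= bump r v <= ln 2.
Proof.
move=> r0; rewrite /bump /logmax -ln_div ?posrE ?lt_max ?r0 ?orbT//; last first.
  by rewrite mulr_gt0 ?orbT.
set x := Num.max _ (2 * r); set y := Num.max _ r.
have y0 : 0 < y by rewrite lt_max r0 orbT.
have yx : y <= x.
  by rewrite ge_max !le_max lexx /=; apply/orP; right; lra.
have x2y : x <= 2 * y.
  have : normc v <= y by rewrite le_max lexx.
  have : r <= y by rewrite le_max lexx orbT.
  by rewrite /x; have [_|_] := leP (normc v) (2 * r); have := normc_ge0 v; lra.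
apply/andP; split; first by rewrite ln_ge0// ler_pdivlMr// mul1r.
by rewrite ler_ln ?posrE ?divr_gt0 ?ler_pdivrMr//; lra.
Qed.

Lemma ln2_ge_half : 1 / 2 <= ln 2 :> R.
Proof.
have h : -1 < - (1 / 2) :> R by lra.
have := le_ln1Dx h; have -> : 1 + - (1 / 2) = 2^-1 :> R by lra.
by rewrite lnV ?posrE// lerN2.
Qed.

End annular_bump.

Section lattice.
Context {R : realType}.

(** Lattice sums are finite sums over boxes of indices, so that they can be
    translated and compared without summability. *)
Definition zrange (a : int) (J : nat) : seq int := [seq a + (k%:Z - J%:Z) | k <- iota 0 (2 * J).+1].

Lemma mem_zrange a J b : (b \in zrange a J) = (a - J%:Z <= b <= a + J%:Z).
Proof.
apply/mapP/idP => [[k]|/andP[ab ba]].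
  by rewrite mem_iota => kJ ->; lia.
exists (absz (b - a + J%:Z)); first by rewrite mem_iota; lia.
lia.
Qed.

Lemma zrange_of_norm (b : int) (H : nat) : `|b| < H%:Z -> 0 - H%:Z <= b <= 0 + H%:Z.
Proof. lia. Qed.

Lemma zrange_uniq a J : uniq (zrange a J).
Proof. by rewrite map_inj_uniq ?iota_uniq// => k l; lia. Qed.

Definition zbox (p : int * int) J : seq (int * int) :=
  [seq (a, b) | a <- zrange p.1 J, b <- zrange p.2 J].

Lemma mem_zbox p J q : (q \in zbox p J) =
  (p.1 - J%:Z <= q.1 <= p.1 + J%:Z) && (p.2 - J%:Z <= q.2 <= p.2 + J%:Z).
Proof.
rewrite -!mem_zrange; apply/allpairsP/andP => [[[a b] /= [aS bS ->]]//|[aS bS]].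
by exists q; split => //; case: q {aS bS}.
Qed.

Lemma zbox_uniq p J : uniq (zbox p J).
Proof. by rewrite allpairs_uniq ?zrange_uniq// => -[a b] [a' b']. Qed.

Lemma size_zbox p J : size (zbox p J) = ((2 * J).+1 ^ 2)%N.
Proof. by rewrite size_allpairs !size_map size_iota. Qed.

Lemma zbox_shift p J : zbox p J = [seq (p.1 + q.1, p.2 + q.2) | q <- zbox (0, 0) J].
Proof.
have E a : zrange a J = [seq a + b | b <- zrange 0 J].
  by rewrite /zrange -map_comp; apply: eq_map => k /=; lia.
by rewrite /zbox (E p.1) (E p.2) allpairs_mapl allpairs_mapr map_allpairs.
Qed.

Lemma sum_support (I : eqType) (s t : seq I) (F : I -> R) : uniq s -> uniq t ->
  (forall i, F i != 0 -> (i \in s) && (i \in t)) ->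
  \sum_(i <- s) F i = \sum_(i <- t) F i.
Proof.
move=> us ut H.
have red (l l' : seq I) : (forall i, F i != 0 -> i \in l') ->
    \sum_(i <- l) F i = \sum_(i <- [seq i <- l | i \in l']) F i.
  move=> Hl; rewrite big_filter [LHS](bigID (fun i => i \in l')) /=.
  rewrite [X in _ + X]big1 ?addr0// => i il.
  by apply/eqP/negPn/negP => /Hl; rewrite (negPf il).
rewrite (red s t) => [|i /H /andP[]//]; rewrite (red t s) => [|i /H /andP[]//].
apply/perm_big/uniq_perm; rewrite ?filter_uniq// => i.
by rewrite !mem_filter andbC.
Qed.

Definition lattice_point (s : R) (p : int * int) : R[i] :=
  Complex (p.1%:~R * s) (p.2%:~R * s).

Lemma lattice_pointD s p q :
  lattice_point s (p.1 + q.1, p.2 + q.2) = lattice_point s p + lattice_point s q.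
Proof.
by rewrite /lattice_point /= !rmorphD /= !mulrDl.
Qed.

Lemma normc_le (u : R[i]) e : `|complex.Re u| <= e -> `|complex.Im u| <= e -> normc u <= 2 * e.
Proof.
move=> ur ui; have e0 : 0 <= e by exact: le_trans ur.
have -> : u = real_complex R (complex.Re u) + Complex 0 1 * real_complex R (complex.Im u).
  by case: u {ur ui} => a b /=; rewrite /real_complex_def; apply/eqP; rewrite eq_complex /=; apply/andP; split; apply/eqP; ring.
apply: le_trans (ler_normcD _ _) _; rewrite normcM !normc_real.
have -> : normc (Complex 0 1) = 1 :> R by rewrite /normc expr0n /= add0r expr1n sqrtr1.
by rewrite mul1r; lra.
Qed.

(** The lattice of step s = r / 2q is periodic, so u may be moved to the nearest
    lattice cell.  The residual shift is at most 2s, which changes each of the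
    (8q + 5)^2 <= 169 q^2 terms by at most 2 / q, while the sum at 0 is at least
    2 q^2, since bumps at lattice points of the disk of radius r are ln 2. *)
Lemma sum_bump_lattice (r : R) (q : nat) (u : R[i]) : 0 < r -> (0 < q)%N ->
  let s := r / (2 * q)%:R in
  let p0 := (Num.floor (complex.Re u / s), Num.floor (complex.Im u / s)) in
  let S0 := \sum_(p <- zbox (0, 0) (4 * q + 2)) bump r (- lattice_point s p) in
  [/\ forall p, bump r (u - lattice_point s p) != 0 -> p \in zbox p0 (4 * q + 2),
      0 < S0 &
      `|\sum_(p <- zbox p0 (4 * q + 2)) bump r (u - lattice_point s p) - S0|
        <= 13 ^+ 2 / q%:R * S0].
Proof.
move=> r0 q0 s p0 S0; set J := (4 * q + 2)%N in S0 *.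
have q0' : 0 < q%:R :> R by rewrite ltr0n.
have q1 : 1 <= q%:R :> R by rewrite ler1n.
have s0 : 0 < s by rewrite divr_gt0// ltr0n muln_gt0.
have rE : r = 2 * q%:R * s by rewrite /s natrM; field; rewrite gt_eqF.
have fl (x : R) : (Num.floor (x / s))%:~R * s <= x < ((Num.floor (x / s))%:~R + 1) * s.
  have F := Num.Theory.floor_itv (x / s).
  by move: F; rewrite rmorphD /= ler_pdivlMr// ltr_pdivrMr.
have S0ge : 2 * q%:R ^+ 2 <= S0.
  have b0 p : 0 <= bump r (- lattice_point s p) by case/andP: (bump_itv (- lattice_point s p) r0).
  pose l := [seq p <- zbox (0, 0) J | p \in zbox (0, 0) q].
  have -> : S0 = \sum_(p <- l) bump r (- lattice_point s p) + \sum_(p <- zbox (0, 0) J | p \notin zbox (0, 0) q) bump r (- lattice_point s p).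
    by rewrite /S0 (bigID (fun p => p \in zbox (0, 0) q)) /= big_filter.
  apply: ler_wpDr; first exact: sumr_ge0.
  have -> : \sum_(p <- l) bump r (- lattice_point s p) = (size (zbox (0, 0) q))%:R * ln 2.
    rewrite (perm_big (zbox (0, 0) q)); last first.
      apply: uniq_perm; rewrite ?filter_uniq ?zbox_uniq// => p.
      by rewrite mem_filter !mem_zbox /= /J; lia.
    rewrite big_seq (eq_bigr (fun=> ln 2)) => [|p]; last first.
      rewrite mem_zbox /= => /andP[H1 H2]; apply: bump_in => //.
      have ub (b : int) : - q%:Z <= b <= q%:Z -> `|b%:~R * s| <= q%:R * s.
        move=> bq; rewrite normrM (gtr0_norm s0) ler_wpM2r ?(ltW s0)//.
        have -> : q%:R = (q%:Z)%:~R :> R by [].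
        by rewrite -intr_norm ler_int; lia.
      rewrite rE -mulrA normc_opp normc_le//=; apply: ub; lia.
    by rewrite -big_seq big_const_seq count_predT iter_addr_0 mulr_natl.
  rewrite size_zbox.
  have -> : ((2 * q).+1 ^ 2)%N%:R = (2 * q%:R + 1) ^+ 2 :> R.
    by rewrite natrX -addn1 natrD natrM.
  have l2 := @ln2_ge_half R.
  by nra.
have S00 : 0 < S0 by apply: lt_le_trans S0ge; rewrite mulr_gt0// exprn_gt0.
split => //.
  move=> p; rewrite mem_zbox /=; apply: contraR => np; apply/eqP/bump_out => //.
  have big1 (x : R) (b : int) : ~~ (Num.floor (x / s) - J%:Z <= b <= Num.floor (x / s) + J%:Z) ->
      2 * r <= `|x - b%:~R * s|.
    have /andP[f1 f2] := fl x; set f := Num.floor _ in f1 f2 *.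
    rewrite rE => /negP H.
    have JE : (J%:Z)%:~R = 4 * q%:R + 2 :> R by rewrite -pmulrn /J natrD natrM.
    (* 2r is 4q steps; rounding u down to the lattice costs at most one more. *)
    have [bf|fb] := ltP b f.
      have H1 : (b + J%:Z + 1)%:~R <= f%:~R :> R by rewrite ler_int; lia.
      rewrite intrD intrD JE in H1.
      have := ler_wpM2r (ltW s0) H1.
      by rewrite ler_normr => H2; apply/orP; left; nra.
    have H1 : (f + J%:Z + 1)%:~R <= b%:~R :> R by rewrite ler_int; lia.
    rewrite intrD intrD JE in H1.
    have := ler_wpM2r (ltW s0) H1.
    by rewrite ler_normr => H2; apply/orP; right; nra.
  case/nandP: np => /big1 H; apply: le_trans H _.
    by apply: le_trans (ler_Re_normc _); rewrite raddfB.
  by apply: le_trans (ler_Im_normc _); rewrite raddfB.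
have near0 : normc (u - lattice_point s p0) <= 2 * s.
  apply: normc_le; rewrite raddfB /= ger0_norm.
  - by have /andP[] := fl (complex.Re u); lra.
  - by have /andP[] := fl (complex.Re u); lra.
  - by have /andP[] := fl (complex.Im u); lra.
  - by have /andP[] := fl (complex.Im u); lra.
rewrite zbox_shift big_map /S0 -sumrB.
apply: le_trans (ler_norm_sum _ _ _) _.
apply: (@le_trans _ _ (\sum_(p <- zbox (0, 0) J) (2 / q%:R))).
  apply: ler_sum => p _; apply: le_trans (bump_lip _ _ r0) _.
  rewrite lattice_pointD.
  have -> : u - (lattice_point s p0 + lattice_point s p) - - lattice_point s p = u - lattice_point s p0 by ring.
  have rs0 : 0 < 2 * q%:R * s by rewrite -rE.
  rewrite rE ler_pdivrMr//.
  have -> : 2 / q%:R * (2 * q%:R * s) = 2 * (2 * s) by field; rewrite gt_eqF.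
  by rewrite ler_wpM2l.
rewrite big_const_seq count_predT iter_addr_0 size_zbox -[leLHS]mulr_natl.
have -> : ((2 * J).+1 ^ 2)%:R = (8 * q%:R + 5) ^+ 2 :> R.
  by rewrite natrX; congr (_ ^+ 2); rewrite /J -addn1 !(natrD, natrM); ring.
rewrite mulrA [leRHS]mulrAC ler_wpM2r ?invr_ge0 ?(ltW q0')//.
have : (8 * q%:R + 5) ^+ 2 <= (13 * q%:R) ^+ 2 :> R.
  by rewrite lerXn2r ?nnegrE; lra.
rewrite exprMn => H; have K0 : 0 <= 13 ^+ 2 :> R by rewrite exprn_ge0.
have := ler_wpM2l K0 S0ge; rewrite -/S0 in H *; lra.
Qed.

End lattice.

(** * Approximation by combinations of bumps *)
Section uniform_approximation.
Context {R : realType}.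

(** A discrete convolution: weight the bump at each lattice point p by h(p) / S0,
    where S0 is the nearly constant value of the sum of all the bumps.  The support
    of a bump has radius 2r < dl, so h varies little on it. *)
Lemma uniform_approximation (h : R[i] -> R) (B L e : R) : 0 < e ->
  (forall u, `|h u| <= B) -> (forall u, L <= normc u -> h u = 0) ->
  (forall e, 0 < e -> exists2 dl, 0 < dl & forall u v, normc (u - v) < dl -> `|h u - h v| < e) ->
  exists (r : rat) (l : seq (R * (rat * rat))), 0 < r /\
    forall u, `|h u - \sum_(i <- l) i.1 * bump (ratr r) (u - rat_complex R i.2)| <= e.
Proof.
move=> e0 hB hL hU.
have B0 : 0 <= B by exact: le_trans (hB 0).
have e4 : 0 < e / 4 by rewrite divr_gt0.
have [dl dl0 Hdl] := hU _ e4.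
have [n n0 n2] : exists2 n : nat, 0 < n%:R :> R & 2 / n%:R < dl.
  exists (Num.truncn (2 / dl)).+1 => //.
  by rewrite ltr_pdivrMr// mulrC -ltr_pdivrMr// truncnS_gt.
have [K KE K0] : exists2 K : R, K = 13 ^+ 2 & 0 < K by exists (13 ^+ 2); rewrite ?exprn_gt0.
have [q q0 qge] : exists2 q, (0 < q)%N & K + 2 * K * B / e <= q%:R.
  by exists (Num.truncn (K + 2 * K * B / e)).+1; last by rewrite ltW// truncnS_gt.
have q0' : 0 < q%:R :> R by rewrite ltr0n.
have Be0 : 0 <= 2 * K * B / e.
  by apply: divr_ge0 (ltW e0); rewrite !mulr_ge0// ltW.
have rho1 : K / q%:R <= 1 by rewrite ler_pdivrMr// mul1r; lra.
have rhoB : B * (K / q%:R) <= e / 2.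
  rewrite mulrA ler_pdivrMr//.
  have : 2 * K * B / e <= q%:R by lra.
  by rewrite ler_pdivrMr//; lra.
pose rq : rat := n%:R^-1.
pose r : R := n%:R^-1.
have rE : ratr rq = r by rewrite /rq fmorphV /= ratr_nat.
have r0 : 0 < r by rewrite invr_gt0.
pose s := r / (2 * q)%:R.
have s0 : 0 < s by rewrite divr_gt0// ltr0n muln_gt0.
pose sq : rat := rq / (2 * q)%:R.
have sE : ratr sq = s by rewrite /sq rmorphM /= rE fmorphV /= ratr_nat.
have [H HL] : exists H : nat, L <= H%:R * s.
  exists (Num.truncn (`|L| / s)).+1.
  by rewrite (le_trans (ler_norm _))// -ler_pdivrMr// ltW// truncnS_gt.
pose S0 := \sum_(p <- zbox (0, 0) (4 * q + 2)) bump r (- lattice_point s p).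
pose l := [seq (h (lattice_point s p) / S0, (p.1%:~R * sq, p.2%:~R * sq) : rat * rat) | p <- zbox (0, 0) H].
exists rq, l; split; first by rewrite -(ltr0q R) rE.
move=> u.
have -> : \sum_(i <- l) i.1 * bump (ratr rq) (u - rat_complex R i.2) =
    \sum_(p <- zbox (0, 0) H) h (lattice_point s p) / S0 * bump r (u - lattice_point s p).
  rewrite big_map; apply: eq_bigr => p _ /=; rewrite rE; congr (_ * bump _ (_ - _)).
  have E (b : int) : ratr (b%:~R * sq) = b%:~R * s by rewrite rmorphM /= ratr_int sE.
  by rewrite /rat_complex /lattice_point !E.
have [supp S00 near] := @sum_bump_lattice R r q u r0 q0.
rewrite -/s -/S0 -KE in supp S00 near.
set p0 := (_, _) in supp near; set J := (4 * q + 2)%N in supp near.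
rewrite (@sum_support _ _ _ (zbox p0 J)) ?zbox_uniq//; last first.
  move=> p; rewrite !mulf_eq0 !negb_or => /andP[/andP[hp _] bp].
  rewrite (supp _ bp) andbT mem_zbox /=.
  have cL : normc (lattice_point s p) < L.
    by rewrite ltNge; apply/negP => /hL hp0; rewrite hp0 eqxx in hp.
  have ub (b : int) : `|b%:~R * s| < L -> 0 - H%:Z <= b <= 0 + H%:Z.
    rewrite normrM (gtr0_norm s0) => bL.
    have : `|b|%:~R * s < H%:R * s by rewrite intr_norm; exact: lt_le_trans HL.
    by rewrite ltr_pM2r// pmulrn ltr_int; exact: zrange_of_norm.
  apply/andP; split; apply: ub; apply: le_lt_trans cL.
    exact: (ler_Re_normc (lattice_point s p)).
  exact: (ler_Im_normc (lattice_point s p)).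
set S := \sum_(p <- _) _ in near.
have b0 p : 0 <= bump r (u - lattice_point s p) by case/andP: (bump_itv (u - lattice_point s p) r0).
have S_ge0 : 0 <= S by exact: sumr_ge0.
have -> : \sum_(p <- zbox p0 J) h (lattice_point s p) / S0 * bump r (u - lattice_point s p) =
  (\sum_(p <- zbox p0 J) h (lattice_point s p) * bump r (u - lattice_point s p)) / S0.
  by rewrite mulr_suml; apply: eq_bigr => p _; ring.
set X := \sum_(p <- _) _.
have X1 : `|h u * S - X| <= e / 4 * S.
  rewrite /S /X mulr_sumr -sumrB (le_trans (ler_norm_sum _ _ _))// mulr_sumr.
  apply: ler_sum => p _; rewrite -mulrBl normrM (ger0_norm (b0 p)).
  have [far|close] := leP (2 * r) (normc (u - lattice_point s p)).
    by rewrite bump_out// !mulr0.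
  by rewrite ler_wpM2r// ltW// Hdl// (lt_trans close)//.
have X2 : `|h u * S0 - X| <= e * S0.
  have -> : h u * S0 - X = (h u * S - X) - h u * (S - S0) by ring.
  apply: le_trans (ler_normB _ _) _; rewrite normrM.
  have Y1 : `|h u| * `|S - S0| <= B * (K / q%:R * S0) by rewrite ler_pM.
  have Y2 : B * (K / q%:R * S0) <= e / 2 * S0 by rewrite mulrA ler_wpM2r// ltW.
  have Y3 : S <= 2 * S0.
    have := ler_norm (S - S0); have : K / q%:R * S0 <= 1 * S0 by rewrite ler_wpM2r// ltW.
    lra.
  have Y4 : e / 4 * S <= e / 4 * (2 * S0) by rewrite ler_wpM2l// ltW.
  lra.
have -> : h u - X / S0 = (h u * S0 - X) / S0 by field; rewrite gt_eqF.
by rewrite normrM normfV (gtr0_norm S00) ler_pdivrMr.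
Qed.

(** Compactness of the segment is used once for each coordinate, in the form that
    a property valid near each point and for small parameters holds on the segment
    for small parameters. *)
Lemma uniform_continuity_box (f : R[i] -> R) (L e : R) : continuous f -> 0 < e ->
  exists2 dl : R, 0 < dl & forall u v, `|complex.Re u| <= L -> `|complex.Im u| <= L ->
    normc (u - v) < dl -> `|f u - f v| < e.
Proof.
move=> cf e0.
pose P (x : R) (b : R) (dl : R) := forall v, normc (Complex x b - v) < dl -> `|f (Complex x b) - f v| < e.
have cover : near_covering `[- L, L]%classic by apply/compact_near_coveringP; exact: segment_compact.
have local (x b : R) : \forall b' \near b & i \near filter_prod (nbhs x) (0 : R)^'+, P i.1 b' i.2.
  have e2 : 0 < e / 2 by rewrite divr_gt0.
  have [dl dl0 Hd] := (iffLR (continuous_normcP f) cf) (Complex x b) _ e2.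
  exists (ball b (dl / 8), [set i | ball x (dl / 8) i.1 /\ 0 < i.2 < dl / 2]) => /=.
    split; first by apply: nbhsx_ballx; rewrite divr_gt0.
    exists (ball x (dl / 8), [set y | 0 < y < dl / 2]) => /=.
      split; first by apply: nbhsx_ballx; rewrite divr_gt0.
      have dl2 : 0 < dl / 2 by rewrite divr_gt0.
      apply: filterS (filterI (nbhs_right_gt 0) (nbhs_right_lt dl2)).
      by move=> y [y0 yd] /=; apply/andP.
    by move=> [y i] /= [].
  move=> [b' [x' i]] /= [bb' [xx' /andP[i0 idl]]] v vi.
  have close : normc (Complex x b - Complex x' b') < dl / 2.
    apply: (@le_lt_trans _ _ (2 * (Num.max `|x - x'| `|b - b'|))).
      by apply: normc_le => /=; rewrite le_max lexx ?orbT.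
    move: xx' bb'; rewrite /ball /= => xx' bb'.
    have : Num.max `|x - x'| `|b - b'| < dl / 8 by rewrite gt_max xx' bb'.
    lra.
  have h1 : `|f (Complex x b) - f (Complex x' b')| < e / 2 by apply: Hd; lra.
  have h2 : `|f (Complex x b) - f v| < e / 2.
    apply: Hd; have -> : Complex x b - v = (Complex x b - Complex x' b') + (Complex x' b' - v) by rewrite addrA subrK.
    apply: le_lt_trans (ler_normcD _ _) _; lra.
  have -> : f (Complex x' b') - f v = (f (Complex x b) - f v) - (f (Complex x b) - f (Complex x' b')) by ring.
  by apply: le_lt_trans (ler_normB _ _) _; lra.
have row (x : R) : \forall x' \near x & dl \near (0 : R)^'+, forall b, `[- L, L]%classic b -> P x' b dl.
  have := @cover _ (filter_prod (nbhs x) (0 : R)^'+) (fun i b => P i.1 b i.2) _ (fun b _ => local x b).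
  by move=> [[U V] /= [HU HV] H]; exists (U, V).
have := @cover _ (0 : R)^'+ (fun dl x => forall b, `[- L, L]%classic b -> P x b dl) _ (fun x _ => row x).
move=> H.
have [dl [dl0 Hdl]] : exists dl : R, 0 < dl /\ forall x, `[- L, L]%classic x -> forall b, `[- L, L]%classic b -> P x b dl.
  have : \forall dl \near (0 : R)^'+, 0 < dl /\ (forall x, `[- L, L]%classic x -> forall b, `[- L, L]%classic b -> P x b dl).
    by apply: filterS (filterI (nbhs_right_gt 0) (H _)) => dl [dl0 Hdl]; split.
  by move/filter_ex.
exists dl => // -[x b] v /= xL bL; apply: Hdl => /=.
  by rewrite in_itv /= -ler_norml.
by rewrite in_itv /= -ler_norml.
Qed.

End uniform_approximation.

(** * Averages over finite families *)
Section empirical_average.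
Context {R : realType}.
Implicit Types (s : seq R[i]) (f g : R[i] -> R).

Definition average s f : R := (size s)%:R^-1 * \sum_(u <- s) f u.

(** Integrals of signed functions are split into positive and negative parts, for
    which integration against sums and multiples of measures is unconditional. *)
Lemma integral_empirical_measure s f : measurable_fun setT f ->
  (\int[empirical_measure s]_z (f z)%:E = (average s f)%:E)%E.
Proof.
move=> mf.
have ge0 (h : R[i] -> R) : measurable_fun setT h -> (forall u, 0 <= h u) ->
    (\int[empirical_measure s]_z (h z)%:E = (average s h)%:E)%E.
  move=> mh h0; rewrite /empirical_measure ge0_integral_mscale//; first last.
  - by move=> u _; rewrite lee_fin.
  - exact/measurable_EFinP.
  rewrite ge0_integral_measure_sum//; first last.
  - exact/measurable_EFinP.
  - by move=> u _; rewrite lee_fin.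
  rewrite /average EFinM; congr (_ * _)%E.
  rewrite (big_nth 0) big_mkord -sumEFin; apply: eq_bigr => k _.
  rewrite integral_dirac//; last exact/measurable_EFinP.
  by rewrite diracT mul1e.
rewrite integralE.
have -> : (fun z => (f z)%:E)^\+%E = (fun z => (f^\+ z)%:E) by apply/funext => u; rewrite funeposE /funrpos -EFin_max.
have -> : (fun z => (f z)%:E)^\-%E = (fun z => (f^\- z)%:E) by apply/funext => u; rewrite funenegE /funrneg -EFin_max.
rewrite !ge0//; [|exact: measurable_funrneg|exact: measurable_funrpos].
rewrite -EFinB /average -mulrBr -sumrB; congr (_ * _)%:E.
apply: eq_bigr => u _; rewrite /funrpos /funrneg.
by have [?|?] := leP (f u) 0; have [?|?] := leP (- f u) 0; lra.
Qed.

Lemma averageD s f g : average s (fun u => f u + g u) = average s f + average s g.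
Proof. by rewrite /average big_split mulrDr. Qed.

Lemma averageZ s c f : average s (fun u => c * f u) = c * average s f.
Proof. by rewrite /average -mulr_sumr mulrCA. Qed.

Lemma average_le s f B : 0 <= B -> (forall u, `|f u| <= B) -> `|average s f| <= B.
Proof.
move=> B0 fB; rewrite /average normrM ger0_norm ?invr_ge0//.
have [->|s0] := eqVneq s [::]; first by rewrite big_nil normr0 mulr0.
have n0 : 0 < (size s)%:R :> R by rewrite ltr0n lt0n size_eq0.
rewrite mulrC ler_pdivrMr// (le_trans (ler_norm_sum _ _ _))//.
rewrite (le_trans (ler_sum _ (fun u _ => fB u)))//.
by rewrite big_const_seq count_predT iter_addr_0 mulr_natr.
Qed.

Lemma average_cst s c : s != [::] -> average s (fun=> c) = c.
Proof.
move=> s0; rewrite /average big_const_seq count_predT iter_addr_0 -[c *+ _]mulr_natl mulrA mulVf ?mul1r//.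
by rewrite pnatr_eq0 size_eq0.
Qed.

Definition plateau (M : R) (u : R[i]) : R := Num.max 0 (Num.min 1 (M + 1 - normc u)).

Lemma plateau_itv M u : 0 <= plateau M u <= 1.
Proof. by rewrite /plateau le_max lexx ge_max ler01 ge_min lexx. Qed.

Lemma plateau_in M u : normc u <= M -> plateau M u = 1.
Proof. by move=> uM; rewrite /plateau min_l ?max_r//; lra. Qed.

Lemma plateau_out M u : M + 1 <= normc u -> plateau M u = 0.
Proof. by move=> uM; rewrite /plateau min_r ?max_l//; lra. Qed.

Lemma continuous_plateau M : continuous (plateau M).
Proof.
apply/continuous_normcP => u e e0; exists e => // v uv.
have := ler_normcB u v; have := ler_normcB v u; rewrite [normc (v - u)]normc_distC.
rewrite /plateau => h1 h2.
set a := M + 1 - normc u; set b := M + 1 - normc v.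
have ab : `|a - b| < e by rewrite /a /b ltr_norml; apply/andP; split; lra.
apply: le_lt_trans ab; rewrite ler_norml; have := ler_norm (a - b); have := ler_norm (b - a).
rewrite [`|b - a|]distrC; have := normr_ge0 (a - b); set c := `|a - b| => c0 c1 c2.
by have [?|?] := leP 1 a; have [?|?] := leP 1 b; rewrite ?(max_r ler01);
  have [?|?] := leP 0 a; have [?|?] := leP 0 b; apply/andP; split; lra.
Qed.

Lemma average_norm_le s f g : (forall u, `|f u| <= g u) -> `|average s f| <= average s g.
Proof.
move=> fg; rewrite /average normrM ger0_norm ?invr_ge0// ler_wpM2l ?invr_ge0//.
by rewrite (le_trans (ler_norm_sum _ _ _))//; apply: ler_sum => u _.
Qed.

End empirical_average.

(** * From bumps to weak convergence *)
Section weak_convergence.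
Context {R : realType}.
Unset Implicit Arguments.
Variables (z : forall n : nat, 'I_n -> R[i]) (W : nat -> seq R[i]).
Set Implicit Arguments.
Hypothesis size_W : forall n, (0 < n)%N -> size (W n) = n.-1.
Let zs n := [seq z n k | k <- enum 'I_n].
Variable mu : {measure set R[i] -> \bar R}.
Hypothesis mu_lim : weakly_converges (fun n => empirical_measure (zs n)) mu.
Hypothesis comparison : some_point_bounded z ->
  forall (q : rat * rat) (r : rat), 0 < r -> forall e, 0 < e ->
  exists N, forall n, (N <= n)%N ->
  `|\sum_(u <- W n) logmax (ratr r) (u - rat_complex R q) -
    \sum_k logmax (ratr r) (z n k - rat_complex R q)| <= e * n%:R.

Let size_zs n : size (zs n) = n.
Proof. by rewrite size_map size_enum_ord. Qed.

(** Test against the constant 1: no mass can be lost at infinity. *)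
Lemma mu_setT : mu setT = 1%E.
Proof.
have c1 : continuous (fun _ : R[i] => 1 : R).
  by apply/continuous_normcP => u e e0; exists 1 => // v _; rewrite subrr normr0.
have b1 : bounded_fun (fun _ : R[i] => 1 : R).
  by exists 1; split => // x x1 u _ /=; rewrite normr1 ltW.
have := mu_lim c1 b1.
rewrite [X in _ --> X]integral_cst// mul1e => H.
apply/esym; apply: (cvg_unique _ _ H) => //.
apply: cvg_near_cst; exists 1%N => // n /= n1.
rewrite integral_empirical_measure//; congr (_%:E); apply: average_cst.
by rewrite -size_eq0 size_zs -lt0n.
Qed.

Lemma average_limit f : continuous f -> bounded_fun f ->
  (average (zs n) f)%:E @[n --> \oo] --> (\int[mu]_u (f u)%:E)%E.
Proof.
move=> cf bf; have := mu_lim cf bf.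
suff -> : (fun n => (average (zs n) f)%:E) =
  (fun n => \int[empirical_measure (zs n)]_u (f u)%:E)%E by [].
apply/funext => n; rewrite integral_empirical_measure//.
exact: continuous_complex_measurable.
Qed.

Lemma bounded_cont f (B : R) : (forall u : R[i], `|f u| <= B) -> bounded_fun (f : R[i] -> R).
Proof.
by move=> fB; exists B; split; [exact: num_real|move=> x Bx u _ /=; apply: le_trans (fB u) (ltW Bx)].
Qed.

Lemma plateau_norm M (u : R[i]) : `|plateau M u| <= 1.
Proof. by have /andP[p0 p1] := plateau_itv M u; rewrite ger0_norm. Qed.

(** Balls of integral radius exhaust the mass of mu, and [plateau] transfers this
    to the averages through weak convergence. *)
Lemma tight (e : R) : 0 < e -> exists M : R, exists N, forall n, (N <= n)%N ->
  1 - e <= average (zs n) (plateau M).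
Proof.
move=> e0.
have cn : continuous (fun u : R[i] => normc u).
  apply/continuous_normcP => u dl dl0; exists dl => // v; apply: le_lt_trans.
  by rewrite ler_norml lerNl opprB {1}normc_distC !ler_normcB.
pose A (k : nat) := [set u : R[i] | normc u <= k%:R].
have mA k : measurable (A k).
  have -> : A k = (fun u : R[i] => normc u) @^-1` `]-oo, k%:R].
    by apply/seteqP; split => u /=; rewrite in_itv.
  rewrite -[X in measurable X]setTI.
  by apply: (continuous_complex_measurable cn) => //; exact: measurable_itv.
have UA : \bigcup_k A k = setT.
  apply/seteqP; split => // u _; exists (Num.truncn (normc u)).+1 => //=.
  exact/ltW/truncnS_gt.
have ndA : nondecreasing_seq A.
  by move=> k l kl; apply/subsetPset => u /= uk; apply: le_trans uk _; rewrite ler_nat.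
have := @nondecreasing_cvg_mu _ _ _ mu A mA (bigcupT_measurable A mA) ndA.
rewrite UA mu_setT => Acvg.
have e2 : 1 - e / 2 < 1 by rewrite ltrBlDr ltrDl divr_gt0.
have [k Hk] : exists k, ((1 - e / 2)%:E < mu (A k))%E.
  have /fine_cvgP[finA fA] := Acvg.
  have [k [fk gk]] := filter_ex (filterI finA (cvgr_gt _ fA _ e2)).
  by exists k; move: fk gk => /= fk gk; rewrite -(fineK fk) lte_fin.
exists k%:R.
have cp := @continuous_plateau R k%:R.
have := average_limit cp (bounded_cont (plateau_norm k%:R)).
have mp := continuous_complex_measurable cp.
have mpE : measurable_fun setT (EFin \o plateau (k%:R : R)) by exact/measurable_EFinP.
set I := (X in _ --> X).
have I1 : (I <= 1)%E.
  rewrite -mu_setT -[leRHS]mul1e -integral_cst//; apply: ge0_le_integral => //.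
  - by move=> u _; rewrite lee_fin; case/andP: (plateau_itv k%:R u).
  - by move=> u _; rewrite /cst lee_fin; case/andP: (plateau_itv k%:R u).
have IA : (mu (A k) <= I)%E.
  rewrite -(setIT (A k)) -integral_indic//; apply: ge0_le_integral => //.
  - by apply/measurable_EFinP; exact: measurable_indic.
  - move=> u _; rewrite lee_fin indicE; have [|_] := boolP (u \in A k).
      by rewrite inE => /= uk; rewrite plateau_in.
    by case/andP: (plateau_itv k%:R u).
have Ifin : I \is a fin_num.
  rewrite ge0_fin_numE ?(le_lt_trans I1) ?ltry//.
  by apply: le_trans IA; exact: measure_ge0.
rewrite -(fineK Ifin) => /fine_cvgP[_ /cvgr_gt] => /(_ (1 - e)).
have I2 : 1 - e < fine I.
  rewrite -lte_fin fineK//; apply: lt_le_trans IA; apply: le_lt_trans Hk.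
  by rewrite lee_fin lerD2l lerN2 ler_pdivrMr// ler_peMr// ?ltW//; lra.
move=> /(_ I2) [N _ HN]; exists N => n Nn; exact/ltW/HN.
Qed.

Lemma tight_some_point_bounded : some_point_bounded z.
Proof.
have h0 : 0 < 1 / 2 :> R by lra.
have [M [N HN]] := tight h0; exists (M + 1), N => n Nn.
apply: contrapT => /forallNP H; have := HN n Nn.
suff -> : average (zs n) (plateau M) = 0 by lra.
rewrite /average big_map big1 ?mulr0// => k _; apply: plateau_out.
by rewrite leNgt; apply/negP => lt; apply: (H k); exact: ltW.
Qed.

Definition gap n f := average (W n) f - average (zs n) f.

Definition small_gap f := forall e : R, 0 < e -> exists N, forall n, (N <= n)%N -> `|gap n f| <= e.

Lemma small_gapD f g : small_gap f -> small_gap g -> small_gap (fun u => f u + g u).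
Proof.
move=> sf sg e e0; have e2 : 0 < e / 2 by rewrite divr_gt0.
have [N1 H1] := sf _ e2; have [N2 H2] := sg _ e2.
exists (maxn N1 N2) => n; rewrite geq_max => /andP[n1 n2].
rewrite /gap !averageD opprD addrACA [leRHS]splitr.
by rewrite (le_trans (ler_normD _ _))// lerD ?H1 ?H2.
Qed.

Lemma small_gapZ c f : small_gap f -> small_gap (fun u => c * f u).
Proof.
move=> sf e e0; have [N H] := sf (e / (`|c| + 1)) (divr_gt0 e0 (ltr_wpDl (normr_ge0 c) ltr01)).
exists N => n /H; rewrite /gap !averageZ -mulrBr normrM.
rewrite ler_pdivlMr ?ltr_wpDl// => h.
apply: le_trans h; rewrite mulrC ler_wpM2l//; lra.
Qed.

Lemma small_gap_sum (I : Type) (l : seq I) (F : I -> R[i] -> R) :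
  (forall i, small_gap (F i)) -> small_gap (fun u => \sum_(i <- l) F i u).
Proof.
move=> sF; elim: l => [|i l IH].
  move=> e e0; exists 0%N => n _.
  have -> : (fun u : R[i] => \sum_(i <- [::]) F i u) = (fun u => 0 * 0) by apply/funext => u; rewrite big_nil mul0r.
  by rewrite /gap !averageZ !mul0r subrr normr0 ltW.
have -> : (fun u => \sum_(i <- i :: l) F i u) = (fun u => F i u + \sum_(i <- l) F i u).
  by apply/funext => u; rewrite big_cons.
exact: small_gapD.
Qed.

Lemma gap_le n f (B : R) : 0 <= B -> (forall u, `|f u| <= B) -> `|gap n f| <= 2 * B.
Proof.
move=> B0 fB; rewrite /gap (le_trans (ler_normB _ _))//.
have := average_le (W n) B0 fB; have := average_le (zs n) B0 fB; lra.
Qed.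

Lemma small_gap_approx f : (forall e : R, 0 < e -> exists2 g, small_gap g &
  forall u, `|f u - g u| <= e) -> small_gap f.
Proof.
move=> H e e0; have e4 : 0 < e / 4 by rewrite divr_gt0.
have [g sg fg] := H _ e4; have [N HN] := sg _ e4; exists N => n Nn.
have -> : f = (fun u => g u + (f u - g u)) by apply/funext => u; rewrite addrC subrK.
have -> : gap n (fun u => g u + (f u - g u)) = gap n g + gap n (fun u => f u - g u).
  by rewrite /gap !averageD opprD addrACA.
apply: le_trans (ler_normD _ _) _.
have := gap_le n (ltW e4) fg; have := HN n Nn; lra.
Qed.

(** The two averages are normalised by n - 1 and n; replacing one factor by the
    other costs at most 1 / n, since bumps are bounded by 1. *)
Lemma small_gap_bump (q : rat * rat) (r : rat) : 0 < r ->
  small_gap (fun u => bump (ratr r) (u - rat_complex R q)).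
Proof.
move=> r0 e e0; have e4 : 0 < e / 4 by rewrite divr_gt0.
have r20 : 0 < 2 * r by rewrite mulr_gt0.
have [N1 H1] := comparison tight_some_point_bounded q r0 e4.
have [N2 H2] := comparison tight_some_point_bounded q r20 e4.
pose N3 := (Num.truncn (2 / e)).+2.
exists (maxn N1 (maxn N2 N3)) => n; rewrite !geq_max => /and3P[/H1 h1 /H2 h2 n3].
have n2 : (1 < n)%N by exact: leq_trans n3.
have rR : 0 < ratr r :> R by rewrite ltr0q.
have r2E : ratr (2 * r) = 2 * ratr r :> R by rewrite rmorphM /= ratr_nat.
have n0 : 0 < n%:R :> R by rewrite ltr0n ltnW.
have m0 : 0 < n%:R - 1 :> R by rewrite subr_gt0 ltr1n.
have nn : 2 / e <= n%:R.
  by rewrite (le_trans (ltW (truncnS_gt _)))// ler_nat ltnW.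
set b := fun u => _.
pose SW := \sum_(u <- W n) b u; pose Sz := \sum_k b (z n k).
have SWz : `|SW - Sz| <= e / 2 * n%:R.
  have -> : SW - Sz = (\sum_(u <- W n) logmax (ratr (2 * r)) (u - rat_complex R q) -
    \sum_k logmax (ratr (2 * r)) (z n k - rat_complex R q)) -
   (\sum_(u <- W n) logmax (ratr r) (u - rat_complex R q) -
    \sum_k logmax (ratr r) (z n k - rat_complex R q)).
    by rewrite /SW /Sz /b /bump !sumrB r2E; ring.
  apply: le_trans (ler_normB _ _) _; lra.
have SWb : `|SW| <= n%:R - 1.
  rewrite /SW (le_trans (ler_norm_sum _ _ _))//.
  apply: (@le_trans _ _ (\sum_(u <- W n) 1)).
    apply: ler_sum => u _; have /andP[b0 b1] := bump_itv (u - rat_complex R q) rR.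
    rewrite ger0_norm// (le_trans b1)//.
    have := @le_ln1Dx R 1 (lt_trans (ltrN10 _) ltr01).
    by rewrite -[1 + 1]/2.
  by rewrite big_const_seq count_predT iter_addr_0 size_W ?(ltnW n2)// -subn1 natrB ?(ltnW n2).
have -> : gap n b = n%:R^-1 * (SW - Sz) + (n%:R * (n%:R - 1))^-1 * SW.
  rewrite /gap /average size_zs size_W ?(ltnW n2)// /zs big_map big_enum /=.
  rewrite -/SW -/Sz -subn1 natrB ?(ltnW n2)//.
  by field; rewrite !gt_eqF.
apply: le_trans (ler_normD _ _) _.
have a1 : `|n%:R^-1 * (SW - Sz)| <= e / 2.
  by rewrite normrM gtr0_norm ?invr_gt0// mulrC ler_pdivrMr.
have a2 : `|(n%:R * (n%:R - 1))^-1 * SW| <= e / 2.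
  rewrite normrM gtr0_norm ?invr_gt0 ?mulr_gt0// mulrC ler_pdivrMr ?mulr_gt0//.
  apply: le_trans SWb _; rewrite mulrA ler_peMl ?(ltW m0)//.
  by move: nn; rewrite ler_pdivrMr//; lra.
lra.
Qed.

Lemma small_gap_compact h (B L : R) : continuous h -> (forall u : R[i], `|h u| <= B) ->
  (forall u, L <= normc u -> h u = 0) -> small_gap h.
Proof.
move=> ch hB hL; apply: small_gap_approx => e e0.
have hU (e1 : R) : 0 < e1 -> exists2 dl, 0 < dl &
    forall u v, normc (u - v) < dl -> `|h u - h v| < e1.
  move=> e10; have [dl dl0 Hd] := uniform_continuity_box (L + 1) ch e10.
  exists (Num.min dl 1) => [|u v]; first by rewrite lt_min dl0 ltr01.
  rewrite lt_min => /andP[uvd uv1].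
  have [ul|ul] := leP (normc u) (L + 1).
    apply: Hd uvd; first exact: le_trans (ler_Re_normc u) ul.
    exact: le_trans (ler_Im_normc u) ul.
  have h1 := ler_normcB u v.
  by rewrite !hL ?subrr ?normr0//; lra.
have [r [l [r0 Hl]]] := uniform_approximation e0 hB hL hU.
exists (fun u => \sum_(i <- l) i.1 * bump (ratr r) (u - rat_complex R i.2)) => //.
by apply: small_gap_sum => i; apply: small_gapZ; exact: small_gap_bump.
Qed.

Lemma continuousM_complex (f g : R[i] -> R) : continuous f -> continuous g ->
  continuous (fun u => f u * g u).
Proof. by move=> cf cg u; exact: (continuousM (cf u) (cg u)). Qed.

(** Cut f off by a plateau.  The zeros are as tight as the points, because the
    plateau itself is a compactly supported test function. *)
Lemma small_gap_bounded f (B : R) : continuous f -> (forall u : R[i], `|f u| <= B) -> small_gap f.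
Proof.
move=> cf fB e e0.
have B0 : 0 <= B by exact: le_trans (fB 0).
have B1 : 0 < 3 * B + 1 by lra.
pose e1 := e / (3 * B + 1).
have e10 : 0 < e1 by rewrite divr_gt0.
have [M [N1 H1]] := tight e10.
have [N2 H2] : exists N, forall n, (N <= n)%N -> `|gap n (plateau M)| <= e1.
  apply: small_gap_compact e10; [exact: continuous_plateau|exact: plateau_norm|exact: plateau_out].
have [N3 H3] : exists N, forall n, (N <= n)%N -> `|gap n (fun u => f u * plateau M u)| <= e1.
  apply: (@small_gap_compact _ B (M + 1)) e10.
  - by apply: continuousM_complex => //; exact: continuous_plateau.
  - move=> u; rewrite normrM -[B]mulr1 ler_pM//; exact: plateau_norm.
  - by move=> u /plateau_out ->; rewrite mulr0.
exists (maxn (maxn N1 N2) (maxn N3 2)) => n.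
rewrite !geq_max => /andP[/andP[/H1 h1 /H2 h2] /andP[/H3 h3 n2]].
have -> : f = (fun u => f u * plateau M u + f u * (1 + -1 * plateau M u)).
  by apply/funext => u; ring.
have -> : gap n (fun u => f u * plateau M u + f u * (1 + -1 * plateau M u)) =
    gap n (fun u => f u * plateau M u) + gap n (fun u => f u * (1 + -1 * plateau M u)).
  by rewrite /gap !averageD opprD addrACA.
have tail s : s != [::] -> `|average s (fun u => f u * (1 + -1 * plateau M u))| <=
    B * (1 - average s (plateau M)).
  move=> s0; apply: (@le_trans _ _ (average s (fun u => B * (1 + -1 * plateau M u)))).
    apply: average_norm_le => u; rewrite normrM.
    have /andP[p0 p1] := plateau_itv M u.
    rewrite [`|1 + _|]ger0_norm; last lra.
    by rewrite ler_wpM2r//; lra.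
  by rewrite averageZ averageD averageZ average_cst// mulN1r.
have W0 : W n != [::] by rewrite -size_eq0 size_W ?(ltnW n2)// -lt0n; lia.
have z0 : zs n != [::] by rewrite -size_eq0 size_zs -lt0n ltnW.
have tW := tail _ W0; have tz := tail _ z0.
have [g1 g2] : average (W n) (plateau M) >= 1 - 2 * e1 /\ average (zs n) (plateau M) >= 1 - e1.
  by split => //; move: h2; rewrite /gap ler_norml => /andP[? ?]; lra.
have tW' : B * (1 - average (W n) (plateau M)) <= B * (2 * e1) by rewrite ler_wpM2l//; lra.
have tz' : B * (1 - average (zs n) (plateau M)) <= B * e1 by rewrite ler_wpM2l//; lra.
apply: le_trans (ler_normD _ _) _.
apply: le_trans (lerD h3 (ler_normB _ _)) _.
have eE : e = e1 * (3 * B + 1) by rewrite /e1 divfK// gt_eqF.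
rewrite eE; lra.
Qed.

Theorem weakly_converges_zeros : weakly_converges (fun n => empirical_measure (W n)) mu.
Proof.
move=> f cf bf.
have [B fB] : exists B : R, forall u : R[i], `|f u| <= B.
  have [M [_ HM]] := bf; exists (M + 1) => u; apply: (HM (M + 1)) => //; lra.
have sg := small_gap_bounded cf fB.
have -> : (fun n => \int[empirical_measure (W n)]_u (f u)%:E)%E =
    (fun n => (average (zs n) f)%:E + (gap n f)%:E)%E.
  apply/funext => n; rewrite integral_empirical_measure; last exact: continuous_complex_measurable.
  by rewrite -EFinD /gap addrC subrK.
rewrite -[X in _ --> X]adde0; apply: cvgeD.
- by rewrite fin_num_adde_defl.
- exact: average_limit.
- apply/cvg_EFin; first by near=> n.
  apply/cvgrPdist_le => e e0; have [N HN] := sg e e0; exists N => // n /= /HN.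
  by rewrite sub0r normrN.
Unshelve. all: by end_near.
Qed.

End weak_convergence.

Unset Implicit Arguments.

Theorem theorem1 (R : realType) (d : measure_display) (T : measurableType d)
    (P : probability T R) (beta : R) (beta_gt0 : 0 < beta)
    (Z : forall n : nat, 'I_n -> {RV P >-> R[i]})
    (g : forall n : nat, 'I_n -> {RV P >-> R})
    (g_indep : forall n : nat, (0 < n)%N -> mutually_independent (g n))
    (g_gamma : forall (n : nat) (k : 'I_n) (A : set R), measurable A ->
      distribution P (g n k) A = gamma_prob (beta / 2) A)
    (gZ_indep : forall n : nat, (0 < n)%N -> independent_families (g n) (Z n))
    (mu : {measure set R[i] -> \bar R})
    (mu_lim : {ae P, forall w : T,
      weakly_converges
        (fun n : nat => empirical_measure [seq Z n k w | k <- enum 'I_n]) mu}) :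
  {ae P, forall w : T,
    weakly_converges
      (fun n : nat => empirical_measure
        (zeros (randomized_derivative (fun k : 'I_n => g n k w)
                                      (fun k : 'I_n => Z n k w)))) mu}.
Proof.
have a0 : 0 < beta / 2 by rewrite divr_gt0.
have H := ae_sum_logmax_sublinear a0 g_indep g_gamma gZ_indep.
apply: filterS2 H mu_lim => w [gpos Hlog] Hlim.
apply: (@weakly_converges_zeros R (fun n k => Z n k w) _ _ _ Hlim) => //.
by move=> n n0; rewrite size_zeros_randomized_derivative// => k.
Qed.
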